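(* Let $C_n$ be a projective primitive multiple curve of multiplicity $n>1$ with associated reduced curve $C$, and let $U\subset C_n$ be an affine open subset admitting a closed embedding in a smooth affine surface $S$. Let $Z\subset U$ be a finite subscheme of length $d>0$ supported at a point $P$, and let $T=\mathcal{O}_Z$. If $Z$ is contained in $C$, then the canonical morphism $$\mathrm{Ext}^1_{\mathcal{O}_{C_n}}(T,T)\longrightarrow\mathrm{Ext}^1_{\mathcal{O}_S}(T,T)$$ is an isomorphism. In other words, the inclusion $\mathrm{Hilb}^d(C_n)_{|U}\subset\mathrm{Hilb}^d(S)$ induces an isomorphism between the tangent spaces at $Z$.
   Context: Everything is over $\mathbb{C}$. Primitive multiple curves: let $X$ be a smooth connected threefold and $C\subset X$ a smooth irreducible projective curve. A primitive multiple curve with support $C$ is a closed Cohen–Macaulay subscheme $Y\subset X$ with $Y_{red}=C$ such that for every closed point $P\in C$ there is a surface in $X$, smooth at $P$, containing a neighbourhood of $P$ in $Y$. Its multiplicity is the smallest $n$ such that $Y$ is contained in the subscheme of $X$ defined by the $n$-th power of the ideal sheaf of $C$ in $X$; write $C_n=Y$. When an open subset $U$ of $C_n$ is embedded in a smooth surface $S$, the local equation of $U$ in $S$ is the $n$-th power of a local equation of $C\cap U$. $\mathrm{Hilb}^d(S)$ is the Hilbert scheme of finite subschemes of length $d$ of $S$, and $\mathrm{Hilb}^d(C_n)_{|U}$ is the closed subscheme of $\mathrm{Hilb}^d(S)$ parametrizing the subschemes contained in $U$ (i.e. the Hilbert scheme of length $d$ finite subschemes of $U$): it is the zero scheme of the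 sections of the tautological rank $d$ bundle on $\mathrm{Hilb}^d(S)$ induced by the elements of the ideal of $U$ in $S$. *)

(* Defs.v *)
From HB Require Import structures.
From mathcomp Require Import all_boot all_order all_algebra.
From mathcomp Require Import all_classical topology.
From mathcomp Require Import complex.
From mathcomp Require Import ring.

Set Implicit Arguments.
Unset Strict Implicit.
Unset Printing Implicit Defensive.

Import GRing.Theory.
Local Open Scope classical_set_scope.
Local Open Scope ring_scope.

(* Rings are [comPzRingType]s: the ring of sections over the empty set is 0.  *)

(** * Commutative algebra *)

Section CommutativeAlgebra.
Variable A : comPzRingType.
Implicit Types (I : set A) (s : seq A).

Definition invertible (a : A) : Prop := exists b, a * b = 1.

Definition is_ideal I : Prop :=
  [/\ I 0, forall x y, I x -> I y -> I (x + y) & forall a x, I x -> I (a * x)].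

Definition is_prime I : Prop :=
  [/\ is_ideal I, ~ I 1 & forall x y, I (x * y) -> I x \/ I y].

Definition ideal_gen s : set A :=
  [set x | exists c : 'I_(size s) -> A, x = \sum_i c i * s`_i].

Definition noetherian : Prop :=
  forall I, is_ideal I -> exists s, I = ideal_gen s.

Definition nonunits : set A := [set a | ~ invertible a].

(* The zero ring is excluded: 0 is then invertible, so nonunits is empty.     *)
Definition local_ring : Prop := is_ideal nonunits.

Definition prime_chain (d : nat) : Prop :=
  exists p : nat -> set A,
    (forall i, (i <= d)%N -> is_prime (p i)) /\
    (forall i, (i < d)%N -> p i `<` p i.+1).

Definition krull_dim (d : nat) : Prop := prime_chain d /\ ~ prime_chain d.+1.

Definition regular_local (d : nat) : Prop :=
  [/\ local_ring, noetherian, krull_dim d &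
      exists s, size s = d /\ nonunits = ideal_gen s].

Definition regular_sequence s : Prop :=
  forall i, (i < size s)%N ->
    forall x, ideal_gen (take i s) (s`_i * x) -> ideal_gen (take i s) x.

(* Properness of the quotients by the initial segments of s is automatic for
   a sequence in the maximal ideal.                                           *)
Definition cohen_macaulay_local : Prop :=
  [/\ local_ring, noetherian &
      exists s, [/\ regular_sequence s, forall a, a \in s -> nonunits a &
                    krull_dim (size s)]].

End CommutativeAlgebra.

(* B / J is a free module of rank d over R (through phi).                     *)
Definition free_quotient (R B : comPzRingType) (phi : R -> B) (J : set B)
    (d : nat) : Prop :=
  exists e : 'I_d -> B, forall b,
    exists! c : {ffun 'I_d -> R}, J (b - \sum_i phi (c i) * e i).

(** * Sheaves and ringed spaces over a field *)

Record opens (T : topologicalType) := Opens {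
  oset :> set T;
  oset_open : open oset }.

Definition omem (T : topologicalType) (U : opens T) (x : T) : Prop := oset U x.
Coercion omem : opens >-> Funclass.

Definition whole (T : topologicalType) : opens T := Opens (@openT T).

Definition open_preimage (S T : topologicalType) (f : S -> T)
    (cf : continuous f) (V : opens T) : opens S :=
  Opens ((continuousP f).1 cf V (@oset_open T V)).

Section Sheaf.
Variables (T : topologicalType) (F : opens T -> Type).
Variable r : forall U V : opens T, V `<=` U -> F U -> F V.

Definition is_presheaf : Prop :=
  (forall (U : opens T) (h : U `<=` U) s, r h s = s) /\
  (forall (U V W : opens T)
     (hVU : V `<=` U) (hWV : W `<=` V) (hWU : W `<=` U) s,
     r hWV (r hVU s) = r hWU s).

Definition has_gluing : Prop :=
  forall (I : Type) (W : I -> opens T) (U : opens T)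
    (hW : forall i, W i `<=` U), U `<=` \bigcup_i W i ->
  forall s : (forall i, F (W i)),
    (forall i j (V : opens T) (hi : V `<=` W i) (hj : V `<=` W j),
       r hi (s i) = r hj (s j)) ->
  exists! t : F U, forall i, r (hW i) t = s i.

Definition is_sheaf : Prop := is_presheaf /\ has_gluing.

End Sheaf.

Record kspace (K : fieldType) := KSpace {
  carrier :> topologicalType;
  sec : opens carrier -> comPzRingType;
  restr : forall U V : opens carrier, V `<=` U -> {rmorphism sec U -> sec V};
  sec_sheaf : is_sheaf (fun U V (h : V `<=` U) => restr h);
  base_cst : {rmorphism K -> sec (whole carrier)} }.

Arguments sec {K} X U : rename.
Arguments restr {K} {X U V} h : rename.
Arguments base_cst {K} X : rename.

Section Schemes.
Variable K : fieldType.
Implicit Types X Y Z : kspace K.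

Definition base_scalar X (U : opens X) (c : K) : sec X U :=
  restr (@subsetT _ U : U `<=` whole X) (base_cst X c).

(* f is a unit in the local ring at x.                                        *)
Definition unit_at X (U : opens X) (f : sec X U) (x : X) : Prop :=
  exists (V : opens X) (h : V `<=` U), V x /\ invertible (restr h f).

Definition unit_locus X (U : opens X) (f : sec X U) : set X :=
  [set x | U x /\ unit_at f x].

(* The canonical map U -> Spec O(U), x |-> {f | f is not a unit at x}, is an
   isomorphism of ringed spaces: a bijection onto the primes, identifying the
   topologies, under which O(D(f)) is the localization O(U)_f.                *)
Definition affine_open X (U : opens X) : Prop :=
  let ev x : set (sec X U) := [set f | ~ unit_at f x] in
  [/\ forall x, U x -> is_prime (ev x),
      forall p, is_prime p -> exists! x, U x /\ ev x = p,
      forall (V : opens X) x, V `<=` U -> V x ->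
        exists f : sec X U, unit_locus f x /\ unit_locus f `<=` V &
      forall (f : sec X U) (V : opens X) (h : V `<=` U),
        oset V = unit_locus f ->
        (forall a, restr h a = 0 -> exists m, f ^+ m * a = 0) /\
        (forall b : sec X V, exists a m, restr h f ^+ m * b = restr h a)].

Definition affine X : Prop := affine_open (whole X).

Definition is_scheme X : Prop :=
  forall x : X, exists U : opens X, U x /\ affine_open U.

(* L, with the maps germ, is the local ring at x.                             *)
Definition is_stalk X (x : X) (L : comPzRingType)
    (germ : forall U : opens X, U x -> {rmorphism sec X U -> L}) : Prop :=
  [/\ forall (U V : opens X) (h : V `<=` U) (hU : U x) (hV : V x) f,
        germ V hV (restr h f) = germ U hU f,
      forall l, exists U hU f, germ U hU f = l &
      forall U hU f, germ U hU f = 0 ->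
        exists (V : opens X) (h : V `<=` U), V x /\ restr h f = 0].

(* P holds for the local ring at x; P is meant to be isomorphism-invariant.   *)
Definition local_at X (x : X) (P : comPzRingType -> Prop) : Prop :=
  exists L germ, @is_stalk X x L germ /\ P L.

Definition regular_at X (x : X) (d : nat) : Prop :=
  local_at x (fun L => regular_local L d).

Definition cohen_macaulay X : Prop :=
  is_scheme X /\ forall x : X, local_at x cohen_macaulay_local.

Definition reduced X : Prop :=
  forall (U : opens X) (f : sec X U) m, f ^+ m = 0 -> f = 0.

Definition irreducible X : Prop :=
  [set: X] !=set0 /\
  forall U V : opens X, U !=set0 -> V !=set0 -> (U `&` V) !=set0.

Definition finite_type X : Prop :=
  compact [set: X] /\
  forall U : opens X, affine_open U ->
    exists s : seq (sec X U), forall Q : set (sec X U),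
      (forall c, Q (base_scalar U c)) -> (forall a, a \in s -> Q a) ->
      (forall a b, Q a -> Q b -> Q (a + b)) ->
      (forall a b, Q a -> Q b -> Q (a * b)) -> forall a, Q a.

(* Over an algebraically closed field of characteristic 0, smooth of pure
   dimension d means regular of dimension d at the closed points.             *)
Definition smooth_of_dim X (d : nat) : Prop :=
  [/\ is_scheme X, finite_type X &
      forall x : X, closed [set x] -> regular_at x d].

(* The diagonal X -> X x X is a closed immersion, read on the affine opens
   U x V of X x X.                                                            *)
Definition separated X : Prop :=
  forall U V W : opens X, affine_open U -> affine_open V ->
  forall (hU : W `<=` U) (hV : W `<=` V), oset W = U `&` V ->
    affine_open W /\
    forall f : sec X W, exists m (a : 'I_m -> sec X U) (b : 'I_m -> sec X V),
      f = \sum_i restr hU (a i) * restr hV (b i).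

(** ** Morphisms *)

Record morph X Y := Morph {
  mfun :> X -> Y;
  mcont : continuous mfun;
  mco : forall V : opens Y,
    {rmorphism sec Y V -> sec X (open_preimage mcont V)};
  mco_res : forall (V W : opens Y) (h : W `<=` V)
    (h' : open_preimage mcont W `<=` open_preimage mcont V) f,
    mco W (restr h f) = restr h' (mco V f);
  mco_cst : forall c, mco (whole Y) (base_cst Y c) = base_scalar _ c;
  mco_local : forall (V : opens Y) (f : sec Y V) x, V (mfun x) ->
    unit_at (mco V f) x -> unit_at f (mfun x) }.

Definition inverse_image X Y (f : morph X Y) (V : opens Y) : opens X :=
  open_preimage (@mcont X Y f) V.

Definition comorph X Y (f : morph X Y) (V : opens Y) :
    {rmorphism sec Y V -> sec X (inverse_image f V)} :=
  @mco X Y f V.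

Definition global_comorph X Y (f : morph X Y) :
    {rmorphism sec Y (whole Y) -> sec X (whole X)} :=
  GRing.RMorphism.clone _ _
    (restr (fun x _ => I : inverse_image f (whole Y) x)
       \o comorph f (whole Y)) _.

Definition closed_immersion X Y (f : morph X Y) : Prop :=
  forall V : opens Y, affine_open V ->
    affine_open (inverse_image f V) /\ forall g, exists a, comorph f V a = g.

End Schemes.

(** ** Open subschemes *)

Section OpenSubscheme.
Variables (K : fieldType) (X : kspace K) (U : opens X).

Lemma open_image_open (V : opens (set_type U)) : open (set_val @` V).
Proof.
have [W oW WV] := @oset_open _ V.
suff -> : set_val @` V = W `&` U by apply: openI => //; exact: oset_open.
apply/seteqP; split => [_ [x Vx <-]|x [Wx Ux]].
  split; last exact: set_valP.
  by move: Vx; rewrite -WV.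
exists (exist _ x (mem_set Ux)); last by rewrite set_valE.
by rewrite -WV /= set_valE.
Qed.

Definition open_image (V : opens (set_type U)) : opens X :=
  Opens (open_image_open V).

Lemma open_image_sub (V W : opens (set_type U)) :
  W `<=` V -> open_image W `<=` open_image V.
Proof. by move=> h; exact: image_subset. Qed.

Definition open_sub_sec (V : opens (set_type U)) : comPzRingType :=
  sec X (open_image V).

Definition open_sub_res (V W : opens (set_type U)) (h : W `<=` V) :
    {rmorphism open_sub_sec V -> open_sub_sec W} :=
  restr (open_image_sub h).

Lemma open_sub_sheaf : is_sheaf (fun V W (h : W `<=` V) => open_sub_res h).
Proof.
have [[rid rcomp] glue] := @sec_sheaf _ X.
split; first split.
- by move=> V h s; exact: rid.
- by move=> V V' W h1 h2 h3 s; exact: rcomp.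
move=> J W V hW cV s hs.
apply: (glue J (fun j => open_image (W j)) (open_image V)
  (fun j => open_image_sub (hW j))).
  by move=> _ [x /cV[j _ Wjx] <-]; exists j => //; exists x.
move=> i j O hi hj.
have oO' : open (set_val @^-1` O : set (set_type U)).
  by exists (oset O) => //; exact: oset_open.
pose O' := Opens oO'.
have h1 : O' `<=` W i.
  by move=> x /hi[y Wy /val_inj yx]; rewrite -yx.
have h2 : O' `<=` W j.
  by move=> x /hj[y Wy /val_inj yx]; rewrite -yx.
have h3 : O `<=` open_image O'.
  move=> x Ox; have [y Wy yx] := hi _ Ox.
  by exists y => //=; rewrite yx.
have := congr1 (restr h3) (hs i j O' h1 h2).
by rewrite /open_sub_res (rcomp _ _ _ _ _ hi) (rcomp _ _ _ _ _ hj).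
Qed.

Definition open_sub_cst : {rmorphism K -> open_sub_sec (whole _)} :=
  GRing.RMorphism.clone _ _
    (restr (@subsetT _ _ : open_image (whole _) `<=` whole X) \o base_cst X) _.

Definition open_sub : kspace K := KSpace open_sub_sheaf open_sub_cst.

Lemma incl_continuous : continuous (set_val : open_sub -> X).
Proof. exact: initial_continuous. Qed.

Lemma incl_image (V : opens X) :
  open_image (open_preimage incl_continuous V) `<=` V.
Proof. by move=> _ [x Vx <-]. Qed.

Definition incl_mco (V : opens X) :
    {rmorphism sec X V -> sec open_sub (open_preimage incl_continuous V)} :=
  restr (incl_image (V := V)).

Lemma incl_local (V : opens X) (f : sec X V) (x : open_sub) :
  V (set_val x) -> unit_at (incl_mco V f) x -> unit_at f (set_val x).
Proof.
have [[rid rcomp] _] := @sec_sheaf _ X.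
move=> Vx [W [h [Wx [b fb]]]].
exists (open_image W).
have h' : open_image W `<=` V by move=> _ [y /h Vy <-].
exists h'; split; first by exists x.
exists b; rewrite -[RHS]fb; congr (_ * _).
by rewrite /= /open_sub_res /incl_mco (rcomp _ _ _ _ _ h').
Qed.

Lemma incl_res (V W : opens X) (h : W `<=` V)
    (h' : open_preimage incl_continuous W `<=` open_preimage incl_continuous V)
    f :
  incl_mco W (restr h f) = restr h' (incl_mco V f).
Proof.
have [[rid rcomp] _] := @sec_sheaf _ X.
have h2 : open_image (open_preimage incl_continuous W) `<=` V.
  by move=> x /incl_image/h.
by rewrite /incl_mco /= /open_sub_res !(rcomp _ _ _ _ _ h2).
Qed.

Lemma incl_cst c : incl_mco (whole X) (base_cst X c) = base_scalar _ c.
Proof.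
have [[rid rcomp] _] := @sec_sheaf _ X.
rewrite /incl_mco /base_scalar /= /open_sub_res.
by rewrite (rcomp _ _ _ _ _ (@incl_image (whole X))).
Qed.

Definition open_incl : morph open_sub X := Morph incl_res incl_cst incl_local.

End OpenSubscheme.

Arguments open_sub {K X} U.
Arguments open_incl {K X} U.

(** * Sheaves of modules *)

Definition rscal (A B : comPzRingType) (phi : {rmorphism A -> B})
  (M : lmodType B) : Type := M.

Section RestrictionOfScalars.
Variables (A B : comPzRingType) (phi : {rmorphism A -> B}) (M : lmodType B).

HB.instance Definition _ := GRing.Zmodule.on (rscal phi M).

Definition rscal_scale (a : A) (m : rscal phi M) : rscal phi M :=
  phi a *: (m : M).

Fact rscal_scaleA a b v :
  rscal_scale a (rscal_scale b v) = rscal_scale (a * b) v.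
Proof. by rewrite /rscal_scale scalerA rmorphM. Qed.
Fact rscal_scale1 : left_id 1 rscal_scale.
Proof. by move=> v; rewrite /rscal_scale rmorph1 scale1r. Qed.
Fact rscal_scaleDr : right_distributive rscal_scale +%R.
Proof. by move=> a u v; rewrite /rscal_scale scalerDr. Qed.
Fact rscal_scaleDl v : {morph rscal_scale^~ v : a b / a + b}.
Proof. by move=> a b; rewrite /rscal_scale rmorphD scalerDl. Qed.

HB.instance Definition _ := GRing.Zmodule_isLmodule.Build A (rscal phi M)
  rscal_scaleA rscal_scale1 rscal_scaleDr rscal_scaleDl.

End RestrictionOfScalars.

Record omod (K : fieldType) (X : kspace K) := OMod {
  msec :> forall U : opens X, lmodType (sec X U);
  mres : forall U V : opens X, V `<=` U -> msec U -> msec V;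
  mresD : forall U V (h : oset V `<=` oset U) m n,
    mres h (m + n) = mres h m + mres h n;
  mresZ : forall U V (h : oset V `<=` oset U) a m,
    mres h (a *: m) = restr h a *: mres h m;
  msec_sheaf : is_sheaf mres }.

Arguments mres {K X} o {U V} h m : rename.

Definition structure_omod (K : fieldType) (X : kspace K) : omod X.
Proof.
apply: (@OMod K X (fun U => (sec X U)^o : lmodType (sec X U))
  (fun U V h => restr h)).
- by move=> U V h m n; exact: rmorphD.
- by move=> U V h a m; exact: rmorphM.
- exact: sec_sheaf.
Defined.

Section Pushforward.
Variables (K : fieldType) (X Y : kspace K) (f : morph X Y) (M : omod X).

Definition push_sec (V : opens Y) : lmodType (sec Y V) :=
  rscal (comorph f V) (M (inverse_image f V)).

Lemma inverse_image_sub (V W : opens Y) :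
  W `<=` V -> inverse_image f W `<=` inverse_image f V.
Proof. by move=> h x; exact: h. Qed.

Definition push_res (V W : opens Y) (h : W `<=` V) : push_sec V -> push_sec W :=
  mres M (inverse_image_sub h).

Lemma push_resD (V W : opens Y) (h : W `<=` V) m n :
  push_res h (m + n) = push_res h m + push_res h n.
Proof. exact: mresD. Qed.

Lemma push_resZ (V W : opens Y) (h : W `<=` V) a m :
  push_res h (a *: m) = restr h a *: push_res h m.
Proof.
have -> : restr h a *: push_res h m =
    (comorph f W (restr h a) : sec X (inverse_image f W)) *:
    mres M (inverse_image_sub h) m by [].
by rewrite /comorph (mco_res h (inverse_image_sub h)); exact: mresZ.
Qed.

Lemma push_sheaf : is_sheaf push_res.
Proof.
have [[mid mcomp] glue] := @msec_sheaf _ _ M.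
split; first split.
- by move=> V h s; exact: mid.
- by move=> V V' W h1 h2 h3 s; exact: mcomp.
move=> J W V hW cV s hs.
apply: (glue J (fun j => inverse_image f (W j)) (inverse_image f V)
  (fun j => inverse_image_sub (hW j))).
  by move=> x /cV[j _ Wj]; exists j.
move=> i j O hi hj.
pose Wij := Opens (openI (@oset_open _ (W i)) (@oset_open _ (W j))).
have h1 : Wij `<=` W i by move=> x [].
have h2 : Wij `<=` W j by move=> x [].
have h3 : O `<=` inverse_image f Wij.
  by move=> x Ox; split; [exact: hi|exact: hj].
have := congr1 (mres M h3) (hs i j Wij h1 h2).
by rewrite /push_res (mcomp _ _ _ _ _ hi) (mcomp _ _ _ _ _ hj).
Qed.

Definition pushforward : omod Y := OMod push_resD push_resZ push_sheaf.

End Pushforward.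

(** * Yoneda Ext^1 *)

Record omod_hom (K : fieldType) (X : kspace K) (M N : omod X) := OModHom {
  hfun :> forall U : opens X, {linear M U -> N U};
  hfun_res : forall (U V : opens X) (h : V `<=` U) m,
    hfun V (mres M h m) = mres N h (hfun U m) }.

(* 0 -> N -> E -> M -> 0; exactness on the left holds on sections.            *)
Record extension (K : fieldType) (X : kspace K) (M N : omod X) := Extension {
  ext_mid :> omod X;
  ext_in : omod_hom N ext_mid;
  ext_out : omod_hom ext_mid M;
  ext_inj : forall U : opens X, injective (ext_in U);
  ext_exact : forall (U : opens X) e,
    ext_out U e = 0 <-> exists n, ext_in U n = e;
  ext_surj : forall (U : opens X) (m : M U) x, U x ->
    exists (V : opens X) (h : V `<=` U),
      V x /\ exists e, ext_out V e = mres M h m }.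

Section Ext1.
Variables (K : fieldType) (X : kspace K) (M N : omod X).
Implicit Types E : extension M N.

(* Two extensions have the same class in Ext^1(M, N); a morphism inducing the
   identity on M and N is an isomorphism.                                     *)
Definition ext_equiv E E' : Prop :=
  exists h : omod_hom E E',
    (forall U n, h U (ext_in E U n) = ext_in E' U n) /\
    (forall U e, ext_out E' U (h U e) = ext_out E U e).

(* [E3] = [E1] + [E2]: E3 is a quotient of the fibre product of E1 and E2 over
   M, on which sigma is defined, inducing the addition N + N -> N.            *)
Definition ext_add E1 E2 E3 : Prop :=
  let fibre (U : opens X) (e : E1 U * E2 U) :=
    ext_out E1 U e.1 = ext_out E2 U e.2 in
  exists sigma : forall U : opens X, E1 U * E2 U -> E3 U,
    [/\ forall (U : opens X) a e e', fibre U e -> fibre U e' ->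
          sigma U (a *: e.1 + e'.1, a *: e.2 + e'.2) =
          a *: sigma U e + sigma U e',
        forall (U V : opens X) (h : V `<=` U) e, fibre U e ->
          sigma V (mres E1 h e.1, mres E2 h e.2) = mres E3 h (sigma U e),
        forall (U : opens X) n1 n2,
          sigma U (ext_in E1 U n1, ext_in E2 U n2) = ext_in E3 U (n1 + n2) &
        forall (U : opens X) e, fibre U e ->
          ext_out E3 U (sigma U e) = ext_out E1 U e.1].

(* [E'] = c [E]: E' is the pushout of E along multiplication by c on N.       *)
Definition ext_scale (c : K) E E' : Prop :=
  exists h : omod_hom E E',
    (forall (U : opens X) n,
       h U (ext_in E U n) = ext_in E' U (base_scalar U c *: n)) /\
    (forall U e, ext_out E' U (h U e) = ext_out E U e).

End Ext1.

(* The relation rel between extensions is the graph of an isomorphism of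
   K-vector spaces Ext^1_X(M, N) -> Ext^1_Y(M', N').                          *)
Definition ext1_isomorphism (K : fieldType) (X Y : kspace K) (M N : omod X)
    (M' N' : omod Y) (rel : extension M N -> extension M' N' -> Prop) : Prop :=
  [/\ forall E, exists F, rel E F,
      forall F, exists E, rel E F,
      forall E1 E2 F1 F2, rel E1 F1 -> rel E2 F2 ->
        (ext_equiv E1 E2 <-> ext_equiv F1 F2),
      forall E1 E2 E3 F1 F2 F3, rel E1 F1 -> rel E2 F2 -> rel E3 F3 ->
        ext_add E1 E2 E3 -> ext_add F1 F2 F3 &
      forall c E1 E2 F1 F2, rel E1 F1 -> rel E2 F2 ->
        ext_scale c E1 E2 -> ext_scale c F1 F2].

(* U is open in Y, k : U -> S is a closed immersion and M is a module on U; F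
   is the extension k_*(E|_U), up to the isomorphism phi and the identification
   of (incl_* M)|_U with M.  The class of F is the image of that of E under the
   canonical map Ext^1_Y -> Ext^1_U -> Ext^1_S, restriction followed by k_*.  *)
Definition ext1_canonical (K : fieldType) (Y S : kspace K) (U : opens Y)
    (k : morph (open_sub U) S) (M : omod (open_sub U))
    (E : extension (pushforward (open_incl U) M) (pushforward (open_incl U) M))
    (F : extension (pushforward k M) (pushforward k M)) : Prop :=
  let over (V : opens S) : opens Y := open_image (inverse_image k V) in
  exists phi : forall V : opens S, E (over V) -> F V,
    [/\ forall V : opens S, bijective (phi V),
        forall (V : opens S) (a : sec S V) e e',
          phi V ((comorph k V a : sec Y (over V)) *: e + e') =
          a *: phi V e + phi V e',
        forall (V W : opens S) (h : W `<=` V) (h' : over W `<=` over V) e,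
          phi W (mres E h' e) = mres F h (phi V e),
        forall (V : opens S)
          (h : inverse_image k V `<=` inverse_image (open_incl U) (over V)) t,
          phi V (ext_in E (over V) t) = ext_in F V (mres M h t) &
        forall (V : opens S)
          (h : inverse_image k V `<=` inverse_image (open_incl U) (over V)) e,
          mres M h (ext_out E (over V) e) = ext_out F V (phi V e)].

(** * First-order deformations *)

Section DualNumbers.
Variable A : comPzRingType.

(* The ring A[eps] / (eps^2), with (a, b) standing for a + b eps.             *)
Definition dual : Type := (A * A)%type.

HB.instance Definition _ := GRing.Zmodule.on dual.

Definition dual_one : dual := (1, 0).
Definition dual_mul (x y : dual) : dual := (x.1 * y.1, x.1 * y.2 + x.2 * y.1).

Fact dual_mulA : associative dual_mul.
Proof. by move=> x y z; congr (_, _) => /=; ring. Qed.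
Fact dual_mulC : commutative dual_mul.
Proof. by move=> x y; congr (_, _) => /=; ring. Qed.
Fact dual_mul1 : left_id dual_one dual_mul.
Proof. by move=> [a b]; congr (_, _) => /=; ring. Qed.
Fact dual_mulD : left_distributive dual_mul +%R.
Proof. by move=> x y z; congr (_, _) => /=; ring. Qed.

HB.instance Definition _ := GRing.Zmodule_isComPzRing.Build dual
  dual_mulA dual_mulC dual_mul1 dual_mulD.

End DualNumbers.

Definition dual_map (A B : comPzRingType) (f : A -> B) (x : dual A) : dual B :=
  (f x.1, f x.2).

Section HilbertTangent.
Variables (K : fieldType) (A : comPzRingType) (iota : {rmorphism K -> A}).
Variables (d : nat) (J : set A).

(* The tangent space at [Spec A/J] of Hilb^d(Spec A), the functor of closed
   subschemes of Spec A that are flat and finite of degree d over the base: its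
   points over K[eps] that reduce to J modulo eps.  (Over the local ring K[eps],
   flat and finite of degree d means free of rank d.)                         *)
Definition hilb_tangent : set (set (dual A)) :=
  [set L | [/\ is_ideal L, free_quotient (dual_map iota) L d &
               [set x.1 | x in L] = J]].

(* The vector space structure of the tangent space of a functor: the sum is
   the image under eps1, eps2 |-> eps of the common extension of L and L' to
   K[eps1, eps2] / (eps1, eps2)^2, and c L is the image of L under
   eps |-> c eps.                                                             *)
Definition tangent_add (L L' : set (dual A)) : set (dual A) :=
  [set x | exists b b', [/\ L (x.1, b), L' (x.1, b') & x.2 = b + b']].

Definition tangent_scale (c : K) (L : set (dual A)) : set (dual A) :=
  [set x | exists b y, [/\ L (x.1, b), J y & x.2 = iota c * b + y]].

End HilbertTangent.

(* L |-> its preimage under f : A -> B is the map induced on tangent spaces by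
   the inclusion Hilb^d(Spec B) -> Hilb^d(Spec A).                            *)
Definition hilb_tangent_isomorphism (K : fieldType) (A B : comPzRingType)
    (iota : {rmorphism K -> A}) (kappa : {rmorphism K -> B})
    (f : {rmorphism A -> B}) (d : nat) (J : set B) : Prop :=
  let df (L : set (dual B)) : set (dual A) := dual_map f @^-1` L in
  let TB := hilb_tangent kappa d J in
  let TA := hilb_tangent iota d (f @^-1` J) in
  [/\ set_bij TB TA df,
      forall L L', TB L -> TB L' ->
        df (tangent_add L L') = tangent_add (df L) (df L') &
      forall c L, TB L ->
        df (tangent_scale kappa J c L) =
        tangent_scale iota (f @^-1` J) c (df L)].

(** * Primitive multiple curves *)

Section Curves.
Variable K : fieldType.
Implicit Types X Y C : kspace K.

(* P is the projective N-space: t i j is the coordinate x_j / x_i on the chart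
   D i = {x_i <> 0}, whose ring is freely generated by the t i j, j <> i.     *)
Definition is_projective_space (N : nat) (P : kspace K) : Prop :=
  exists (D : 'I_N.+1 -> opens P) (t : forall i, 'I_N.+1 -> sec P (D i)),
    [/\ forall x, exists i, D i x,
        forall i, affine_open (D i) /\ t i i = 1,
        forall i (B : comPzRingType) (g : {rmorphism K -> B})
          (b : 'I_N.+1 -> B), b i = 1 ->
          exists phi : {rmorphism sec P (D i) -> B},
            [/\ forall c, phi (base_scalar (D i) c) = g c,
                forall j, phi (t i j) = b j &
                forall psi : {rmorphism sec P (D i) -> B},
                  (forall c, psi (base_scalar (D i) c) = g c) ->
                  (forall j, psi (t i j) = b j) -> psi =1 phi],
        forall i j x, D i x -> (D j x <-> unit_at (t i j) x) &
        forall i j k (W : opens P) (hi : W `<=` D i) (hj : W `<=` D j),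
          restr hi (t i k) = restr hi (t i j) * restr hj (t j k)].

Definition projective X : Prop :=
  exists N (P : kspace K) (f : morph X P),
    [/\ is_scheme P, is_projective_space N P & closed_immersion f].

(* c : C -> Y is the inclusion of the associated reduced curve.               *)
Definition is_reduction Y C (c : morph C Y) : Prop :=
  [/\ closed_immersion c, reduced C & forall y, exists x, c x = y].

(* Near the closed point P of C, the subscheme Y of X is contained in a surface
   S' (closed in an open subset W of X) that is smooth at P.                  *)
Definition locally_in_smooth_surface X Y (i : morph Y X) (P : X) : Prop :=
  exists (W : opens X) (S' : kspace K) (s : morph S' (open_sub W)),
    [/\ is_scheme S', closed_immersion s,
        exists Q : S', open_incl W (s Q) = P /\ regular_at Q 2 &
        forall (V : opens X) (f : sec X V), V `<=` W ->
          comorph s _ (comorph (open_incl W) V f) = 0 -> comorph i V f = 0].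

(* Y is contained in the subscheme of X defined by the m-th power of the ideal
   sheaf of C: sections of a power of a sheaf of ideals are locally sums of
   products of sections.                                                      *)
Definition in_ideal_power X Y C (i : morph Y X) (c : morph C Y) (m : nat) :
    Prop :=
  forall (W : opens X) (f : 'I_m -> sec X W),
    (forall j, comorph c _ (comorph i W (f j)) = 0) ->
    comorph i W (\prod_j f j) = 0.

Definition is_multiplicity X Y C (i : morph Y X) (c : morph C Y) (n : nat) :
    Prop :=
  in_ideal_power i c n /\ forall m, in_ideal_power i c m -> (n <= m)%N.

Record primitive_multiple_curve X Y C (i : morph Y X) (c : morph C Y)
    (n : nat) : Prop := PrimitiveMultipleCurve {
  pmc_threefold : [/\ smooth_of_dim X 3, separated X & connected [set: X]];
  pmc_support : [/\ smooth_of_dim C 1, irreducible C & projective C];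
  pmc_closed : closed_immersion i;
  pmc_cm : cohen_macaulay Y;
  pmc_red : is_reduction c;
  pmc_primitive :
    forall P : C, closed [set P] -> locally_in_smooth_surface i (i (c P));
  pmc_multiplicity : is_multiplicity i c n }.

Definition smooth_affine_surface (S : kspace K) : Prop :=
  affine S /\ smooth_of_dim S 2.

Definition has_length (Z : kspace K) (d : nat) : Prop :=
  free_quotient (base_cst Z) [set 0] d.

Definition contained_in Y C Z (U : opens Y) (z : morph Z (open_sub U))
    (c : morph C Y) : Prop :=
  forall (V : opens Y) (f : sec Y V),
    comorph c V f = 0 -> comorph z _ (comorph (open_incl U) V f) = 0.

Definition subscheme_ideal X Z (z : morph Z X) : set (sec X (whole X)) :=
  [set f | global_comorph z f = 0].

End Curves.

(* Main.v *)
Require Import Defs.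
From HB Require Import structures.
From mathcomp Require Import all_boot all_order all_algebra.
From mathcomp Require Import all_classical reals topology complex.
From mathcomp Require Import ring.

(* Let A = O(S), let I be the ideal of U in A and J the ideal of Z in A.  All
   rests on the inclusion I <= J^2.  The curve C is regular of dimension 1 and S
   is regular of dimension 2, so at P the ideal of C in S is generated by one
   element f, and f lies in J since Z is contained in C.  If g = f h lies in I
   and h is not in (f), then h is regular in the Cohen-Macaulay ring O_{C_n,P}, so
   f vanishes there and C_n is reduced at P; as C_n is irreducible without
   embedded points, it is then reduced everywhere, contrary to n > 1.  Hence I is
   contained in (f^2) at P.

   J^2 annihilates every extension of O_Z by O_Z on S, because J maps it into
   the submodule O_Z and kills that submodule; so the extension is a module on
   U.  A first-order deformation of Z in S has, by flatness, an ideal containing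
   a lift of each element of J and all of eps J; so it contains J^2, hence I,
   and lies in U.                                                            *)

Set Implicit Arguments.
Unset Strict Implicit.
Unset Printing Implicit Defensive.

Import GRing.Theory.
Local Open Scope classical_set_scope.
Local Open Scope ring_scope.

(** * Local algebra *)

(** The spaces contain nonclosed points, while regularity of [C] and [S] is given at closed points
    only. So [P] must first be shown to be closed, which comes from the finite length of [Z]. For
    the same reason, the vanishing of the ideal of [C] is carried from [P] to another point of [C_n]
    through a closed specialization of that point: there an element that is not zero on [C] is
    regular in the Cohen-Macaulay local ring.

    The inclusion in [J^2] is obtained in local rings. The tangent spaces need it in [O(S)], where
    it follows after clearing a denominator that is invertible on [Z].

    For extensions the obstacle is that opens of [S] and of [C_n] do not correspond, and that
    sections lift along [k] only near [k P]. But every module involved vanishes on the opens that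
    miss a closed point, so restriction between opens through that point is bijective: each
    construction is made on one small open and carried to the others. *)

Lemma invertibleM (A : comPzRingType) (a b : A) :
  invertible a -> invertible b -> invertible (a * b).
Proof.
move=> [a' aa'] [b' bb']; exists (a' * b').
by rewrite mulrACA aa' bb' mulr1.
Qed.

Lemma invertible_factor (A : comPzRingType) (a b : A) :
  invertible (a * b) -> invertible a.
Proof. by move=> [c abc]; exists (b * c); rewrite mulrA. Qed.

Lemma invertible_rmorph (A B : comPzRingType) (f : {rmorphism A -> B}) a :
  invertible a -> invertible (f a).
Proof. by move=> [b ab]; exists (f b); rewrite -rmorphM ab rmorph1. Qed.

Lemma invertible_cancel (A : comPzRingType) (u x : A) :
  invertible u -> u * x = 0 -> x = 0.
Proof. by move=> [v uv] ux; rewrite -[x]mul1r -uv mulrAC ux mul0r. Qed.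

Lemma invertibleX (A : comPzRingType) (u : A) k :
  invertible u -> invertible (u ^+ k).
Proof. by move=> [v uv]; exists (v ^+ k); rewrite -exprMn uv expr1n. Qed.

Lemma local_ring_nonzero (A : comPzRingType) : local_ring A -> (1 : A) <> 0.
Proof.
by move=> [h0 _ _] e; apply: h0; exists 1; rewrite mulr1 e.
Qed.

Lemma local_ring_sub1 (A : comPzRingType) (x : A) :
  local_ring A -> ~ invertible x -> invertible (1 - x).
Proof.
move=> [_ hD _] nx; apply: contrapT => n1x.
have : nonunits (1 : A) by rewrite -(subrK x 1); exact: hD.
by apply; exists 1; rewrite mulr1.
Qed.

Lemma ideal_gen1 (A : comPzRingType) (a x : A) :
  ideal_gen [:: a] x <-> exists b, x = b * a.
Proof.
split=> [[c ->]|[b ->]]; first by exists (c ord0); rewrite big_ord1.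
by exists (fun=> b); rewrite big_ord1.
Qed.

Lemma ideal_gen2 (A : comPzRingType) (a b x : A) :
  ideal_gen [:: a; b] x <-> exists c d, x = c * a + d * b.
Proof.
split=> [[c ->]|[c [d ->]]].
  by exists (c ord0), (c (lift ord0 ord0)); rewrite big_ord_recl big_ord1.
exists (fun i => if i == ord0 then c else d).
by rewrite big_ord_recl big_ord1.
Qed.

(** The ideals [(f, b 0, ..., b (N - 1))] increase and their union [I] is finitely generated, so it
    is already reached at some [N]. *)
Lemma noetherian_sequence (A : comPzRingType) (f : A) (b : nat -> A) :
  noetherian A -> exists N (c : 'I_N -> A) (e : A),
    b N = e * f + \sum_(i < N) c i * b i.
Proof.
move=> noeA.
pose I := [set x | exists N (c : 'I_N -> A) e,
  x = e * f + \sum_(i < N) c i * b i].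
have widen N M (c : 'I_N -> A) : (N <= M)%N -> exists c' : 'I_M -> A,
    \sum_(i < N) c i * b i = \sum_(i < M) c' i * b i.
  move=> NM; pose F i : A := if insub i is Some j then c j else 0.
  exists (fun i => F i); transitivity (\sum_(i < N) F i * b i).
    by apply: eq_bigr => i _; rewrite /F valK.
  rewrite (big_ord_widen M (fun i => F i * b i) NM).
  rewrite [RHS](bigID (fun i : 'I_M => (i < N)%N)) /=.
  rewrite [X in _ = _ + X]big1 ?addr0 // => i iN.
  by rewrite /F insubN // mul0r.
have idI : is_ideal I.
  split.
  - by exists 0%N, (fun=> 0), 0; rewrite big_ord0 mul0r addr0.
  - move=> x y [N [c [e ->]]] [M [d [e' ->]]].
    have [c' ->] := widen _ _ c (leq_maxl N M).
    have [d' ->] := widen _ _ d (leq_maxr N M).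
    exists (maxn N M), (fun i => c' i + d' i), (e + e').
    rewrite addrACA mulrDl -big_split; congr (_ + _).
    by apply: eq_bigr => i _; rewrite /= mulrDl.
  - move=> a x [N [c [e ->]]]; exists N, (fun i => a * c i), (a * e).
    rewrite mulrDr mulrA mulr_sumr; congr (_ + _).
    by apply: eq_bigr => i _; rewrite mulrA.
have [s Is] := noeA I idI.
have memI (i : 'I_(size s)) : I s`_i.
  by rewrite Is; exists (fun j => (j == i)%:R); rewrite (bigD1 i) //= eqxx mul1r
    big1 ?addr0 // => j /negPf ->; rewrite mul0r.
have [N hN] : exists N, forall i : 'I_(size s), exists (c : 'I_N -> A) e,
    s`_i = e * f + \sum_(j < N) c j * b j.
  have /choice[M hM] := memI.
  exists (\max_i M i)%N => i; have [c [e ->]] := hM i.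
  have [c' ->] := widen _ _ c (leq_bigmax i).
  by exists c', e.
have : I (b N).
  exists N.+1, (fun i : 'I_N.+1 => (val i == N)%:R), 0.
  rewrite mul0r add0r (bigD1 ord_max) //= eqxx mul1r big1 ?addr0 //.
  by move=> i; rewrite -val_eqE /= => /negPf ->; rewrite mul0r.
rewrite Is => -[a bN].
have /choice[c /choice[e hs]] := hN.
exists N, (fun j => \sum_i a i * c i j), (\sum_i a i * e i).
rewrite bN mulr_suml -[X in _ = _ + X](_ : \sum_i a i * \sum_(j < N) c i j * b j = _).
  by rewrite -big_split; apply: eq_bigr => i _; rewrite hs mulrDr mulrA.
under eq_bigr do rewrite mulr_sumr.
rewrite exchange_big; apply: eq_bigr => j _; rewrite mulr_suml.
by apply: eq_bigr => i _; rewrite mulrA.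
Qed.

(** Krull's intersection theorem in [A / (f)] for the powers of [t]. The chain condition is applied
    to the coefficients [y k] themselves; multiplying the resulting relation by [t ^+ N] puts
    [u * g] in [(f)] for some [u] in [1 + (t)], a unit. *)
Lemma krull_intersection (A : comPzRingType) (f t g : A) :
  local_ring A -> noetherian A -> ~ invertible t ->
  (forall k, exists x y, g = x * f + y * t ^+ k) -> exists x, g = x * f.
Proof.
move=> locA noeA nt /choice[x /choice[y gE]].
have [N [c [e yN]]] := noetherian_sequence f y noeA.
(* y N = e f + sum c i y i, and y i t^N = t^(N-i) (g - x i f) *)
pose u := 1 - t * \sum_(i < N) c i * t ^+ (N - i.+1).
have uu : invertible u.
  by apply: local_ring_sub1 => // /invertible_factor.
have [v uv] := uu.
suff [w hw] : exists w, u * g = w * f.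
  by exists (v * w); rewrite -mulrA -hw mulrA (mulrC v) uv mul1r.
exists (x N + e * t ^+ N - \sum_(i < N) c i * t ^+ (N - i) * x i).
rewrite /u mulrBl mul1r {1}(gE N) yN !mulrDl mulNr -!addrA; congr (_ + _).
rewrite mulrAC; congr (_ + _).
rewrite mulr_sumr !mulr_suml -!sumrN -big_split; apply: eq_bigr => i _ /=.
have -> : t ^+ N = t ^+ (N - i) * t ^+ i by rewrite -exprD subnK // ltnW.
have -> : t * (c i * t ^+ (N - i.+1)) = c i * t ^+ (N - i).
  by rewrite mulrCA -exprS subnSK.
rewrite {1}(gE i); ring.
Qed.

(** The ring is a discrete valuation ring. The factorization of [x] comes from Krull's theorem with
    [f = 0], which bounds the powers of [t] dividing [x]. *)
Lemma regular_local1_uniformizer (L : comPzRingType) :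
  regular_local L 1 -> exists t : L,
  [/\ ~ invertible t, forall k, t ^+ k <> 0,
      forall x, ~ invertible x -> exists y, x = y * t &
      forall x, x <> 0 -> exists k u, invertible u /\ x = u * t ^+ k].
Proof.
move=> [locL noeL [[p [pP pS]] _] [s [ss sE]]].
case: s ss sE => [//|t [|//]] _ sE; exists t.
have nt : ~ invertible t.
  suff : nonunits t by [].
  by rewrite sE; apply/ideal_gen1; exists 1; rewrite mul1r.
have gen x : ~ invertible x -> exists y, x = y * t.
  by move=> nx; apply/ideal_gen1; rewrite -sE.
have [_ p0X] : is_prime (p 0%N) by exact: pP.
(* A nilpotent [t] would lie in [p 0], giving [p 1] inside [(t)] inside [p 0], against the strict
   inclusion. *)
have nX k : t ^+ k <> 0.
  move=> tk.
  have [[p00 p0D p0M] p01 p0P] := pP 0%N isT.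
  have p0t : p 0%N t.
    elim: k tk => [|k IHk] tk; first by case: p01; rewrite -(expr0 t) tk.
    have : p 0%N (t ^+ k.+1) by rewrite tk.
    elim: k.+1 {IHk tk} => [|j IH]; first by rewrite expr0 => /p01.
    by rewrite exprS => /p0P[//|/IH].
  have [sub nsub] := pS 0%N isT; apply: nsub => x p1x.
  have [[_ _ p1M] p11 _] := pP 1%N isT.
  have [y ->] : exists y, x = y * t.
    apply: gen => -[y xy]; apply: p11.
    by rewrite -xy mulrC; exact: p1M.
  exact: p0M.
split=> // x x0.
have [k hk] : exists k, ~ exists y, x = y * t ^+ k.
  apply: contrapT => H; apply: x0.
  have [//|y ->] := @krull_intersection L 0 t x locL noeL nt; last by rewrite mulr0.
  move=> k; have [[y ->]|h] := pselect (exists y, x = y * t ^+ k).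
    by exists 0, y; rewrite mul0r add0r.
  by case: H; exists k.
elim: k hk => [|k IHk] hk.
  by case: hk; exists x; rewrite expr0 mulr1.
have [[y xy]|/IHk//] := pselect (exists y, x = y * t ^+ k).
exists k, y; split=> //; apply: contrapT => /gen[w yw].
by apply: hk; exists w; rewrite xy yw exprS mulrA.
Qed.

Definition nil_kernel (A B : comPzRingType) (f : A -> B) :=
  forall a, f a = 0 -> exists m, a ^+ m = 0.

Definition onto (A B : Type) (f : A -> B) := forall b, exists a, f a = b.

(** Lift an inverse of [f a] to [b']. Then [1 - a * b'] maps to 0, so it is a nonunit, and locality
    makes [a * b'] a unit. *)
Lemma onto_nonunit (A B : comPzRingType) (f : {rmorphism A -> B}) a :
  local_ring A -> onto f -> (1 : B) <> 0 -> ~ invertible a -> ~ invertible (f a).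
Proof.
move=> locA sf nz na [b ab].
have [b' fb'] := sf b.
have : invertible (1 - (1 - a * b')).
  apply: (@local_ring_sub1 _ _ locA) => /(invertible_rmorph f)[e].
  by rewrite rmorphB rmorph1 rmorphM fb' ab subrr mul0r => /esym.
by rewrite opprB addrCA subrr addr0 => /invertible_factor.
Qed.

(* An element h with nonzero image in the reduction L_C divides a power of the
   regular element x given by the Cohen-Macaulay property.                   *)
Lemma cm_regular (LY LC : comPzRingType) (psi : {rmorphism LY -> LC}) (h b : LY) :
  cohen_macaulay_local LY -> regular_local LC 1 ->
  onto psi -> nil_kernel psi -> psi h <> 0 -> h * b = 0 -> b = 0.
Proof.
move=> [locY _ [s [regs nus [chain nchain]]]] regC spsi nilpsi hn0 hb0.
have [t [nt tX gen val]] := regular_local1_uniformizer regC.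
have [x [nx xreg]] : exists x : LY, ~ invertible x /\
    forall y, x * y = 0 -> y = 0.
  (* An empty sequence would mean dimension 0, but the chain of primes of [LC] pulls back to
     [LY]. *)
  case: s regs nus chain nchain => [|x s] regs nus chain nchain.
    case: nchain => {chain regs nus}.
    have [_ _ [[p [pP pS]] _] _] := regC.
    exists (fun i => psi @^-1` (p i)); split=> i hi.
      have [[p0 pD pM] p1 pr] := pP i hi.
      split; first split=> [|y z|y z]; rewrite /= ?rmorph0 ?rmorphD ?rmorphM //.
      + exact: pD.
      + exact: pM.
      + by rewrite rmorph1.
      + by move=> y z /=; rewrite rmorphM => /pr.
    have [sub nsub] := pS i hi; split=> [y /sub//|H]; apply: nsub => y.
    by have [w <-] := spsi y; exact: H.
  exists x; split; first by apply: nus; rewrite inE eqxx.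
  move=> y xy; have [] := regs 0%N isT y; first by exists (fun=> 0); rewrite big_ord0.
  by move=> c; rewrite big_ord0.
(* [psi h] is a unit times [t ^+ k] and [psi x] is a multiple of [t], so [psi h] divides
   [psi x ^+ k]. Hence [x ^+ k - h * e] is nilpotent for some [e], and it acts on [b] as [x ^+ k]
   does because [h * b = 0]. *)
have [k [u [[v uv] hE]]] := val _ hn0.
have [y xE] : exists y, psi x = y * t.
  by apply: gen; apply: onto_nonunit => //; apply: local_ring_nonzero; case: regC.
have [e eE] := spsi (v * y ^+ k).
have [m hm] : exists m, (x ^+ k - h * e) ^+ m = 0.
  apply: nilpsi; rewrite rmorphB rmorphXn rmorphM xE hE eE exprMn.
  rewrite [X in _ - X](_ : _ = (u * v) * (y ^+ k * t ^+ k)); last by ring.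
  by rewrite uv mul1r subrr.
have xb : (x ^+ k) ^+ m * b = 0.
  have -> : (x ^+ k) ^+ m * b = (x ^+ k - h * e) ^+ m * b; last by rewrite hm mul0r.
  elim: m {hm} => [//|m IH]; rewrite !exprS -!mulrA IH mulrBl.
  rewrite [X in _ = _ - X](_ : _ = (x ^+ k - h * e) ^+ m * e * (h * b)); last by ring.
  by rewrite hb0 mulr0 subr0.
move: xb; rewrite -exprM; elim: (k * m)%N => [|j IH]; first by rewrite mul1r.
by rewrite exprS -mulrA => /xreg.
Qed.

(** A lift [t'] of the uniformizer belongs to a minimal set of generators of the maximal ideal, and
    the other generator can be corrected by a multiple of [t'] so as to lie in the kernel. Krull's
    theorem then shows that it generates the kernel. *)
Lemma principal_kernel (LS LC : comPzRingType) (psi : {rmorphism LS -> LC}) :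
  regular_local LS 2 -> regular_local LC 1 -> onto psi ->
  exists f, psi f = 0 /\ forall g, psi g = 0 -> exists x, g = x * f.
Proof.
move=> [locS noeS _ [s [ss sE]]] regC spsi.
case: s ss sE => [//|u [//|v [|//]]] _ sE.
have [t [nt tX gen val]] := regular_local1_uniformizer regC.
have nzC : (1 : LC) <> 0 by apply: local_ring_nonzero; case: regC.
have [t' t'E] := spsi t.
have nt' : ~ invertible t' by move=> /(invertible_rmorph psi); rewrite t'E.
have mE x : ~ invertible x <-> exists c d, x = c * u + d * v.
  by rewrite -ideal_gen2 -sE.
have nu : ~ invertible u by apply/mE; exists 1, 0; ring.
have nv : ~ invertible v by apply/mE; exists 0, 1; ring.
have [a [b t'uv]] := (mE t').1 nt'.
have lift1 w : ~ invertible w -> exists e, psi w = psi e * t.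
  move=> nw; have [|y ->] := gen (psi w).
    exact: onto_nonunit.
  by have [e <-] := spsi y; exists e.
suff [f [f0 fm]] : exists f, psi f = 0 /\
    forall x, ~ invertible x -> exists c d, x = c * f + d * t'.
  (* In [g = x f + y t'^k] the coefficient [y] cannot be a unit, as its image times [t ^+ k] is 0;
     so [y] lies in [(f, t')] and the exponent can be raised. *)
  exists f; split=> // g g0; apply: (@krull_intersection _ f t' g) => // k.
  elim: k => [|k [x [y gE]]]; first by exists 0, g; rewrite mul0r add0r mulr1.
  have ny : ~ invertible y.
    move=> /(invertible_rmorph psi)[w yw]; apply: (tX k).
    rewrite -[LHS]mul1r -yw mulrAC -t'E -rmorphXn -rmorphM.
    have -> : y * t' ^+ k = g - x * f by rewrite gE; ring.
    by rewrite rmorphB rmorphM g0 f0 mulr0 subr0 mul0r.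
  have [c [d yE]] := fm _ ny.
  by exists (x + c * t' ^+ k), d; rewrite gE yE exprS; ring.
(* If [a] is a unit, [t'] replaces [u] as a generator, and [v - e t'] has image 0; the case of [b]
   is symmetric. *)
have [ua|na] := pselect (invertible a).
  have [a' aa'] := ua; have [e ve] := lift1 _ nv.
  exists (v - e * t'); split; first by rewrite rmorphB rmorphM t'E ve subrr.
  move=> x /mE[c [d ->]].
  have -> : u = a' * (t' - b * v).
    by rewrite t'uv addrK mulrA (mulrC a') aa' mul1r.
  exists (d - c * a' * b), (c * a' + (d - c * a' * b) * e); ring.
have [ub|nb] := pselect (invertible b).
  have [b' bb'] := ub; have [e ue] := lift1 _ nu.
  exists (u - e * t'); split; first by rewrite rmorphB rmorphM t'E ue subrr.
  move=> x /mE[c [d ->]].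
  have -> : v = b' * (t' - a * u).
    by rewrite t'uv addrC addKr mulrA (mulrC b') bb' mul1r.
  exists (c - d * b' * a), (d * b' + (c - d * b' * a) * e); ring.
(* otherwise t' lies in the square of the maximal ideal, hence t in (t^2) *)
have [ea aE] := lift1 _ na; have [eb bE] := lift1 _ nb.
have [eu uE] := lift1 _ nu; have [ev vE] := lift1 _ nv.
case: (tX 1%N); rewrite expr1.
apply: (@invertible_cancel _ (1 - t * (psi ea * psi eu + psi eb * psi ev))).
  apply: local_ring_sub1 => [|/invertible_factor//]; by case: regC.
rewrite mulrBl mul1r {1}[t](_ : t = psi a * psi u + psi b * psi v); last first.
  by rewrite -t'E t'uv rmorphD !rmorphM.
by rewrite aE bE uE vE; ring.
Qed.

Lemma kernel_in_square (LS LY LC : comPzRingType)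
    (phi : {rmorphism LS -> LY}) (psi : {rmorphism LY -> LC}) :
  regular_local LS 2 -> cohen_macaulay_local LY -> regular_local LC 1 ->
  onto phi -> onto psi -> nil_kernel psi ->
  (exists a, psi a = 0 /\ a <> 0) ->
  forall g, phi g = 0 -> exists f1 f2,
    [/\ psi (phi f1) = 0, psi (phi f2) = 0 & g = f1 * f2].
Proof.
move=> regS cmY regC sphi spsi nilpsi [a [a0 an0]] g g0.
have sc : onto (psi \o phi).
  by move=> y; have [x <-] := spsi y; have [w <-] := sphi x; exists w.
have [f [f0 fgen]] := principal_kernel (psi := psi \o phi) regS regC sc.
have [h gE] : exists x, g = x * f by apply: fgen; rewrite /= g0 rmorph0.
(* Either [h] lies in the ideal of [C], and [h * f] is the wanted product, or [h] is regular in
   [LY]; then [phi f = 0], so that [a], a multiple of it, would vanish. *)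
have [h0|hn0] := pselect (psi (phi h) = 0).
  by exists h, f.
case: an0; have [a' aE] := sphi a.
have [x a'E] : exists x, a' = x * f by apply: fgen; rewrite /= aE.
rewrite -aE a'E rmorphM; suff -> : phi f = 0 by rewrite mulr0.
apply: (cm_regular cmY regC spsi nilpsi hn0).
by rewrite -rmorphM -gE.
Qed.

(** * Sections and points of ringed spaces *)

Lemma opens_ext (T : topologicalType) (U V : opens T) : oset U = oset V -> U = V.
Proof.
case: U V => [U oU] [V oV] /= UV; case: _ / UV oV => oV.
by rewrite (Prop_irrelevance oU oV).
Qed.

Definition opensI (T : topologicalType) (U V : opens T) : opens T :=
  Opens (openI (@oset_open _ U) (@oset_open _ V)).

Lemma opensIl (T : topologicalType) (U V : opens T) : opensI U V `<=` U.
Proof. by move=> x []. Qed.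

Lemma opensIr (T : topologicalType) (U V : opens T) : opensI U V `<=` V.
Proof. by move=> x []. Qed.

Lemma open_locally (T : topologicalType) (A : set T) :
  (forall x, A x -> exists V : opens T, V x /\ V `<=` A) -> open A.
Proof.
move=> h; suff -> : A = \bigcup_(V in [set V : opens T | V `<=` A]) oset V.
  by apply: bigcup_open => V _; exact: oset_open.
apply/seteqP; split=> [x /h[V [Vx VA]]|x [V VA Vx]]; first by exists V.
exact: VA.
Qed.

(** The condition on [y] says that [y] lies in the closure of [x]: closed points are those without
    proper specialization. *)
Lemma closed1P (T : topologicalType) (x : T) :
  closed [set x] <-> forall y, (forall V : opens T, V y -> V x) -> y = x.
Proof.
split=> [cx y h|h].
  apply: contrapT => yx.
  have oC : open (~` [set x]) by rewrite openC.
  by apply: (h (Opens oC) yx).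
rewrite -openC; apply: open_locally => y yx; apply: contrapT => H.
apply: yx; apply: h => V Vy; apply: contrapT => Vx; apply: H.
by exists V; split=> // z Vz zx; apply: Vx; rewrite -zx.
Qed.

Section Restriction.
Variables (K : fieldType) (X : kspace K).
Implicit Types U V W : opens X.

Lemma restr_id U (h : U `<=` U) (s : sec X U) : restr h s = s.
Proof. by have [[rid _] _] := @sec_sheaf _ X; exact: rid. Qed.

Lemma restr_comp U V W (hVU : V `<=` U) (hWV : W `<=` V) (hWU : W `<=` U)
  (s : sec X U) : restr hWV (restr hVU s) = restr hWU s.
Proof. by have [[_ rc] _] := @sec_sheaf _ X; exact: rc. Qed.

Lemma restr_cancel U V (h : V `<=` U) (h' : U `<=` V) :
  cancel (restr h) (restr h').
Proof. by move=> s; rewrite (restr_comp _ _ (@subset_refl _ U)) restr_id. Qed.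

Lemma sec_local U (f g : sec X U) :
  (forall x, U x -> exists V (h : V `<=` U), V x /\ restr h f = restr h g) ->
  f = g.
Proof.
move=> H; have [[rid rc] glue] := @sec_sheaf _ X.
pose I := {V : opens X | exists h : V `<=` U, restr h f = restr h g}.
pose W (i : I) := sval i.
have hW (i : I) : W i `<=` U by have [h _] := svalP i.
have eW (i : I) : restr (hW i) f = restr (hW i) g.
  by have [h e] := svalP i; rewrite (Prop_irrelevance (hW i) h).
have cov : U `<=` \bigcup_i W i.
  move=> x /H[V [h [Vx e]]].
  by exists (exist _ V (ex_intro _ h e)).
have [|t [_ tu]] := glue I W U hW cov (fun i => restr (hW i) f).
  move=> i j V hi hj.
  by rewrite !(restr_comp _ _ (subset_trans hi (hW i))).
by rewrite -(tu f) // -(tu g).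
Qed.

Lemma sec_empty U (f g : sec X U) : (forall x, ~ U x) -> f = g.
Proof. by move=> U0; apply: sec_local => x /U0. Qed.

Lemma unit_at_sub U (f : sec X U) x : unit_at f x -> U x.
Proof. by move=> [V [h [Vx _]]]; exact: h. Qed.

Lemma unit_at_restr U V (h : V `<=` U) (f : sec X U) x : V x ->
  unit_at (restr h f) x <-> unit_at f x.
Proof.
move=> Vx; split=> [[W [hW [Wx i]]]|[W [hW [Wx i]]]].
  exists W, (subset_trans hW h); split=> //.
  by rewrite -(restr_comp h hW).
exists (opensI W V), (@opensIr _ W V); split=> //.
rewrite (restr_comp _ _ (subset_trans (@opensIl _ W V) hW)).
rewrite -(restr_comp hW (@opensIl _ W V)).
exact: invertible_rmorph.
Qed.

Lemma invertible_unit_at U (f : sec X U) x : U x -> invertible f -> unit_at f x.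
Proof.
by move=> Ux fi; exists U, (@subset_refl _ U); split=> //; rewrite restr_id.
Qed.

Lemma unit_atM U (f g : sec X U) x :
  unit_at (f * g) x <-> unit_at f x /\ unit_at g x.
Proof.
split=> [[V [h [Vx]]]|[[V [h [Vx fi]]] [W [h' [Wx gi]]]]].
  rewrite rmorphM => i; split; exists V, h; split=> //.
    exact: invertible_factor i.
  by move: i; rewrite mulrC => /invertible_factor.
exists (opensI V W), (subset_trans (@opensIl _ V W) h); split=> //.
rewrite rmorphM; apply: invertibleM.
  by rewrite -(restr_comp h (@opensIl _ V W)); exact: invertible_rmorph.
rewrite -(restr_comp h' (@opensIr _ V W)); exact: invertible_rmorph.
Qed.

Lemma unit_locus_open U (f : sec X U) : open (unit_locus f).
Proof.
apply: open_locally => x [Ux [V [h [Vx i]]]].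
exists V; split=> // y Vy; split; first exact: (h y Vy).
by exists V, h.
Qed.

Definition basic U (f : sec X U) : opens X := Opens (unit_locus_open f).

Lemma basic_sub U (f : sec X U) : basic f `<=` U.
Proof. by move=> x []. Qed.

Lemma basicP U (f : sec X U) x : basic f x <-> unit_at f x.
Proof. by split=> [[]//|h]; split=> //; exact: unit_at_sub h. Qed.

(** Inverses are unique, so local ones agree on overlaps and glue. *)
Lemma invertible_local U (f : sec X U) :
  (forall x, U x -> unit_at f x) -> invertible f.
Proof.
move=> H; have [[rid rc] glue] := @sec_sheaf _ X.
pose I := {V : opens X | exists h : V `<=` U, invertible (restr h f)}.
pose W (i : I) := sval i.
have hW (i : I) : W i `<=` U by have [h _] := svalP i.
have ex (i : I) : exists g, restr (hW i) f * g = 1.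
  by have [h [g e]] := svalP i; exists g; rewrite (Prop_irrelevance (hW i) h).
pose s i := sval (cid (ex i)).
have sE i : restr (hW i) f * s i = 1 := svalP (cid (ex i)).
have cov : U `<=` \bigcup_i W i.
  move=> x /H[V [h [Vx e]]].
  by exists (exist _ V (ex_intro _ h e)).
have uniq_inv (A : comPzRingType) (a b c : A) : a * b = 1 -> a * c = 1 -> b = c.
  by move=> ab ac; rewrite -[c]mul1r -ab mulrAC ac mul1r.
have compat i j V (hi : V `<=` W i) (hj : V `<=` W j) :
    restr hi (s i) = restr hj (s j).
  apply: (uniq_inv _ (restr (subset_trans hi (hW i)) f)).
    by rewrite -(restr_comp (hW i) hi) -rmorphM sE rmorph1.
  by rewrite (Prop_irrelevance (subset_trans hi _) (subset_trans hj (hW j)))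
    -(restr_comp (hW j) hj) -rmorphM sE rmorph1.
have [t [tE _]] := glue I W U hW cov s compat.
exists t; apply: sec_local => x /cov[i _ Wx].
by exists (W i), (hW i); split=> //; rewrite rmorphM tE sE rmorph1.
Qed.

Lemma basic_invertible U (f : sec X U) : invertible (restr (basic_sub (f:=f)) f).
Proof. by apply: invertible_local => x fx; apply/unit_at_restr => //; case: fx. Qed.

Section Affine.
Variable V : opens X.
Hypothesis affV : affine_open V.

Lemma affine_nbhd W x : V x -> W x ->
  exists f : sec X V, unit_at f x /\ basic f `<=` W.
Proof.
move=> Vx Wx; have [_ _ bas _] := affV.
have [|//|f [[_ fx] fW]] := bas (opensI V W) x; first exact: opensIl.
by exists f; split=> // y /fW[].
Qed.

Lemma affine_kill (f a : sec X V) :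
  restr (basic_sub (f:=f)) a = 0 -> exists m, f ^+ m * a = 0.
Proof.
have [_ _ _ loc] := affV.
by have [k _] := loc f _ (basic_sub (f:=f)) erefl; exact: k.
Qed.

Lemma affine_frac (f : sec X V) (W : opens X) (h : W `<=` V) (b : sec X W) :
  oset W = unit_locus f -> exists a m, restr h f ^+ m * b = restr h a.
Proof. by have [_ _ _ loc] := affV => /(loc f W h)[_]; exact. Qed.

(** The locus of [f] is empty, so 1 restricts to 0 there and is killed by a power of [f]. *)
Lemma affine_nilpotent (f : sec X V) :
  (forall x, V x -> ~ unit_at f x) -> exists m, f ^+ m = 0.
Proof.
move=> H; have [|m e] := @affine_kill f 1; last by exists m; rewrite -[LHS]mulr1.
by apply: sec_empty => x [Vx]; exact: H.
Qed.

Lemma affine_unit0 x : V x -> ~ unit_at (0 : sec X V) x.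
Proof. by move=> Vx; have [pr _ _ _] := affV; have [[]] := pr _ Vx. Qed.

Lemma affine_specialization x y : V y ->
  (forall f : sec X V, unit_at f y -> unit_at f x) ->
  forall W : opens X, W y -> W x.
Proof.
move=> Vy H W Wy; have [f [fy fW]] := affine_nbhd Vy Wy.
by apply: fW; apply/basicP; exact: H.
Qed.

End Affine.

(** In an affine neighbourhood, points lying in the same opens have the same prime, and a point is
    determined by its prime. *)
Lemma scheme_T0 (x y : X) : is_scheme X ->
  (forall W : opens X, W x -> W y) -> (forall W : opens X, W y -> W x) -> x = y.
Proof.
move=> sX xy yx; have [V [Vx affV]] := sX x.
have [pr uq _ _] := affV.
have [z [_ zu]] := uq _ (pr x Vx).
rewrite -(zu x) // -(zu y) //; split; first exact: xy.
apply/seteqP; split=> f nf fu; apply: nf.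
  have [_] : basic f y by apply: xy; split.
  by [].
have [_] : basic f x by apply: yx; split=> //; exact: xy.
by [].
Qed.

Lemma scheme_unit0 U x : is_scheme X -> U x -> ~ unit_at (0 : sec X U) x.
Proof.
move=> sX Ux; have [V [Vx affV]] := sX x.
rewrite -(@unit_at_restr U (opensI U V) (@opensIl _ U V)) // rmorph0.
rewrite -(rmorph0 (restr (@opensIr _ U V))) unit_at_restr //.
exact: affine_unit0.
Qed.

(** Zorn's lemma gives a minimal nonempty closed subset of the closure of [x]; the T0 property makes
    its points closed. *)
Lemma closed_point_exists (x : X) : is_scheme X -> compact [set: X] ->
  exists y : X, closed [set y] /\ forall W : opens X, W y -> W x.
Proof.
move=> sX cX.
pose T := {A : set X | [/\ closed A, A !=set0 & A `<=` closure [set x]]}.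
pose mkT A (p : [/\ closed A, A !=set0 & A `<=` closure [set x]]) : T := exist _ A p.
pose R (A B : T) := `[< sval B `<=` sval A >].
have [|||A totA|M maxM] := @Zorn T R.
- by move=> A; apply/asboolP.
- by move=> A B C /asboolP h1 /asboolP h2; apply/asboolP; exact: subset_trans h2 h1.
- move=> A B /asboolP h1 /asboolP h2; apply: eq_sig_hprop.
    by move=> C p q; exact: Prop_irrelevance.
  by apply/seteqP; split.
- have Tx : [/\ closed (closure [set x]), closure [set x] !=set0 &
      closure [set x] `<=` closure [set x]].
    by split=> //; [exact: closed_closure | exists x; exact: subset_closure].
  have [[A0 AA0]|nA] := pselect (A !=set0); last first.
    by exists (mkT _ Tx) => s As; case: nA; exists s.
  (* The members of the chain generate a proper filter; by compactness it has a cluster point, which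
     lies in all of them because they are closed. *)
  pose F := filter_from A (fun B => sval B).
  have PF : ProperFilter F.
    apply: filter_from_proper; last by move=> B _; have [] := svalP B.
    apply: filter_from_filter; first by exists A0.
    move=> B C AB AC; have [/asboolP h|/asboolP h] := totA B C AB AC.
      by exists C => // y Cy; split=> //; exact: h.
    by exists B => // y By; split=> //; exact: h.
  have FT : F setT by exists A0.
  have [y [_ Fy]] := cX F PF FT.
  have cl (B : T) : A B -> sval B y.
    move=> AB; have [clB _ _] := svalP B; apply: clB => O Oy.
    by apply: Fy => //; exists B.
  have TI : [/\ closed (\bigcap_(B in A) sval B), (\bigcap_(B in A) sval B) !=set0 &
      (\bigcap_(B in A) sval B) `<=` closure [set x]].
    split; first by by apply: closed_bigI => B AB; have [] := svalP B.
    - by exists y => B /cl.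
    - by move=> z hz; have [_ _] := svalP A0; apply; exact: hz.
  exists (mkT _ TI) => B AB; apply/asboolP => z; exact.
have [clM [y My] Mx] := svalP M.
(* Otherwise [sval M] minus [W] would be a smaller nonempty closed set, since [y] is removed. *)
have sub (z : X) : sval M z -> forall W : opens X, W y -> W z.
  move=> Mz W Wy; apply: contrapT => nWz.
  have TM : [/\ closed (sval M `&` ~` W), sval M `&` ~` W !=set0 &
      sval M `&` ~` W `<=` closure [set x]].
    split; last by move=> u [/Mx].
    - by apply: closedI => //; rewrite closedC; exact: oset_open.
    - by exists z.
  have MT : mkT _ TM = M by apply: maxM; apply/asboolP => u [].
  by move: My; rewrite -MT => -[].
exists y; split.
  apply/closed1P => z hz; apply: scheme_T0 => //; last first.
    apply: sub; apply: clM => O; rewrite nbhsE => -[O' [oO' O'z] OO'].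
    by exists y; split=> //; apply: OO'; apply: (hz (Opens oO')).
move=> W Wy; have := Mx _ My W; rewrite nbhsE => -[|z [-> //]].
by exists W => //; split=> //; exact: oset_open.
Qed.

End Restriction.

Section Stalk.
Variables (K : fieldType) (X : kspace K) (x : X) (L : comPzRingType).
Variable germ : forall U : opens X, U x -> {rmorphism sec X U -> L}.
Hypothesis stL : is_stalk germ.
Implicit Types U V W : opens X.

Lemma germ_restr U V (h : V `<=` U) (hU : U x) (hV : V x) f :
  germ hV (restr h f) = germ hU f.
Proof. by have [gr _ _] := stL; exact: gr. Qed.

Lemma germ_eq U V (hU : U x) (hV : V x) f g : germ hU f = germ hV g ->
  exists W (h : W `<=` U) (h' : W `<=` V), W x /\ restr h f = restr h' g.
Proof.
move=> e; have [gr _ g0] := stL.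
have hI : opensI U V x by [].
have [|W [h [Wx e0]]] := g0 _ hI
    (restr (@opensIl _ U V) f - restr (@opensIr _ U V) g).
  by rewrite rmorphB !germ_restr // e subrr.
exists W, (subset_trans h (@opensIl _ U V)), (subset_trans h (@opensIr _ U V)).
split=> //; rewrite -(restr_comp (@opensIl _ U V) h) -(restr_comp (@opensIr _ U V) h).
by apply: subr0_eq; rewrite -rmorphB e0.
Qed.

Lemma germ_unit U (hU : U x) f : invertible (germ hU f) <-> unit_at f x.
Proof.
split=> [[l fl]|[V [h [Vx i]]]]; last first.
  rewrite -(germ_restr h hU Vx); exact: invertible_rmorph.
have [_ gs _] := stL; have [V [hV [g gE]]] := gs l.
have hI : opensI U V x by [].
have /germ_eq[W [h [h' [Wx e]]]] :
    germ hI (restr (@opensIl _ U V) f * restr (@opensIr _ U V) g) = germ hU 1.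
  by rewrite rmorphM !germ_restr // gE fl rmorph1.
exists W, h'; split=> //; exists (restr (subset_trans h (@opensIr _ U V)) g).
move: e; rewrite rmorphM rmorph1 => <-.
by rewrite -(restr_comp (@opensIr _ U V) h) (restr_comp _ _ h').
Qed.

End Stalk.

(** * Morphisms and closed immersions *)

Section Morphism.
Variables (K : fieldType) (X Y : kspace K) (f : morph X Y).

Lemma comorph_restr (V W : opens Y) (h : W `<=` V)
    (h' : inverse_image f W `<=` inverse_image f V) a :
  comorph f W (restr h a) = restr h' (comorph f V a).
Proof. exact: (mco_res h h'). Qed.

Lemma inverse_image_mono (V W : opens Y) :
  W `<=` V -> inverse_image f W `<=` inverse_image f V.
Proof. by move=> h x; exact: h. Qed.

Lemma comorph_scalar (V : opens Y) c :
  comorph f V (base_scalar V c) = base_scalar (inverse_image f V) c.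
Proof.
rewrite /base_scalar (comorph_restr _ (@inverse_image_mono (whole Y) V (@subsetT _ V))).
rewrite [comorph f _ _]mco_cst /base_scalar.
exact: restr_comp.
Qed.

Lemma comorph_unit (V : opens Y) (a : sec Y V) x : V (f x) ->
  unit_at (comorph f V a) x <-> unit_at a (f x).
Proof.
move=> Vx; split; first exact: mco_local.
move=> [W [h [Wx i]]]; exists (inverse_image f W), (inverse_image_mono h).
split=> //; rewrite -(comorph_restr h); exact: invertible_rmorph.
Qed.

Lemma inverse_image_basic (V : opens Y) (a : sec Y V) :
  oset (inverse_image f (basic a)) = unit_locus (comorph f V a).
Proof.
apply/seteqP; split=> x.
  by move=> [Vx ax]; split=> //; apply/comorph_unit.
by move=> [Vx /(comorph_unit a Vx) ax]; split.
Qed.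

Lemma global_comorphE (g : sec Y (whole Y)) (V : opens Y) (h : V `<=` whole Y)
    (h' : inverse_image f V `<=` whole X) :
  restr h' (global_comorph f g) = comorph f V (restr h g).
Proof.
rewrite (comorph_restr h (inverse_image_mono h)).
exact: restr_comp.
Qed.

Lemma global_comorph_onto : affine Y -> closed_immersion f ->
  onto (global_comorph f).
Proof.
move=> affY clf g; have [_ sur] := clf _ affY.
(* The opens [inverse_image f (whole Y)] and [whole X] have the same points but are different terms;
   mutually inverse restrictions pass between their sections. *)
have hX : inverse_image f (whole Y) `<=` whole X by [].
have [a aE] := sur (restr hX g).
exists a; apply: (can_inj (restr_cancel hX (fun x _ => I : inverse_image f (whole Y) x))).
by rewrite (global_comorphE _ (@subset_refl _ (whole Y))) restr_id.
Qed.

Lemma global_comorph_scalar x :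
  global_comorph f (base_cst Y x) = base_cst X x.
Proof.
have hX : inverse_image f (whole Y) `<=` whole X by [].
apply: (can_inj (restr_cancel hX (fun x _ => I : inverse_image f (whole Y) x))).
rewrite (global_comorphE _ (@subset_refl _ (whole Y))) restr_id [comorph f _ _]mco_cst.
exact: (congr1 (fun h => restr h _) (Prop_irrelevance _ _)).
Qed.

Section ClosedImmersion.
Hypothesis clf : closed_immersion f.
Hypothesis sY : is_scheme Y.

(** On an affine open the comorphism is onto, so the prime of a point upstairs is determined by that
    of its image. *)
Lemma closed_immersion_inj : injective f.
Proof.
move=> x y fxy; have [V [Vx affV]] := sY (f x).
have [[pr uq _ _] _] := clf affV.
have [z [_ zu]] := uq _ (pr x Vx).
have Vy : V (f y) by rewrite -fxy.
rewrite -(zu x) // -(zu y) //; split=> //.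
have [_ sur] := clf affV.
by apply/seteqP; split=> g; have [a <-] := sur g;
  move=> /= ng gu; apply: ng; move: gu; rewrite !comorph_unit ?fxy.
Qed.

(** Near [x] the section is a fraction [c / b ^+ m] on an affine inverse image. Lifting [c] and [b]
    to [c'] and [a] gives a fraction on [basic a], whose inverse image is the locus of [b]. That
    locus lies in [W], so opens of [X] are also seen to be locally pulled back from [Y]. *)
Lemma closed_immersion_lift (W : opens X) (V : opens Y) x (s : sec X W) :
  W x -> V (f x) -> exists (V' : opens Y) (h : inverse_image f V' `<=` W),
    [/\ V' (f x), V' `<=` V & exists a, comorph f V' a = restr h s].
Proof.
move=> Wx Vx; have [V0 [V0x affV]] := sY (f x).
have [affW sur] := clf affV.
have [b [bx bW]] := affine_nbhd affW (x := x) (W := opensI W (inverse_image f V))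
  V0x (conj Wx Vx).
have [a ba] := sur b.
have ax : unit_at a (f x) by rewrite -comorph_unit // ba.
have eqD : oset (inverse_image f (basic a)) = unit_locus b.
  by rewrite inverse_image_basic ba.
have hW : inverse_image f (basic a) `<=` W by rewrite eqD => y /bW[].
have [c [m cE]] := affine_frac affW (inverse_image_mono (@basic_sub _ _ _ a))
  (restr hW s) eqD.
have [c' c'E] := sur c.
have [ai aE] := basic_invertible a.
have hV' : opensI (basic a) V `<=` basic a by exact: opensIl.
exists (opensI (basic a) V), (subset_trans (inverse_image_mono hV') hW).
split; first by split=> //; apply/basicP.
  exact: opensIr.
exists (restr hV' (ai ^+ m * restr (@basic_sub _ _ _ a) c')).
rewrite (comorph_restr _ (inverse_image_mono hV')).
rewrite -(restr_comp hW (inverse_image_mono hV')); congr (restr _ _).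
rewrite rmorphM (comorph_restr _ (inverse_image_mono (@basic_sub _ _ _ a))).
rewrite c'E -cE -ba -(comorph_restr (@basic_sub _ _ _ a)).
by rewrite mulrA -rmorphXn -rmorphM -exprMn (mulrC ai) aE expr1n rmorph1 mul1r.
Qed.

Lemma closed_immersion_nbhd (W : opens X) (V : opens Y) x :
  W x -> V (f x) ->
  exists V' : opens Y, [/\ V' (f x), V' `<=` V & inverse_image f V' `<=` W].
Proof.
move=> Wx Vx.
have [V' [h [V'x V'V _]]] := closed_immersion_lift 0 Wx Vx.
by exists V'.
Qed.

Lemma comorph_zero_near (V : opens Y) x (a : sec Y V) (W : opens X)
    (h : W `<=` inverse_image f V) : W x ->
  restr h (comorph f V a) = 0 ->
  exists (V' : opens Y) (h' : V' `<=` V),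
    [/\ V' (f x), comorph f V' (restr h' a) = 0 & inverse_image f V' `<=` W].
Proof.
move=> Wx e; have [V' [V'x V'V sub]] := closed_immersion_nbhd Wx (h _ Wx).
exists V', V'V; split=> //.
rewrite (comorph_restr _ (inverse_image_mono V'V)).
by rewrite -(restr_comp h sub) e rmorph0.
Qed.

(** The image is stable under specialization: a section in the kernel of the comorphism is a nonunit
    at [f x], hence at [q], so the prime of [q] contains the kernel and comes from a point [u]. *)
Lemma closed_immersion_specialization (x : X) (q : Y) (V : opens Y) :
  affine_open V -> V q -> (forall W : opens Y, W q -> W (f x)) ->
  exists u, f u = q /\ forall W : opens X, W u -> W x.
Proof.
move=> affV Vq hq; have [affW sur] := clf affV.
have Vx : V (f x) by exact: hq.
have spec (a : sec Y V) : unit_at a q -> unit_at a (f x).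
  by move=> aq; have [] : basic a (f x) by apply: hq; split.
have [prY uqY _ _] := affV; have [prX uqX _ _] := affW.
have [[q0 qD qM] q1 qP] := prY q Vq.
have subq (a b : sec Y V) : ~ unit_at a q -> ~ unit_at b q -> ~ unit_at (a - b) q.
  by move=> na nb; apply: qD => //; rewrite -mulN1r; exact: qM.
have kerq (a b : sec Y V) : comorph f V a = comorph f V b -> ~ unit_at a q ->
    ~ unit_at b q.
  move=> e na; have nab : ~ unit_at (a - b) q.
    move=> /spec; rewrite -comorph_unit // rmorphB e subrr.
    exact: affine_unit0.
  by rewrite -[b](subKr a); exact: subq.
have pr : is_prime [set g | exists a, comorph f V a = g /\ ~ unit_at a q].
  split; first split.
  - by exists 0; rewrite rmorph0.
  - move=> _ _ [a [<- na]] [b [<- nb]]; exists (a + b); rewrite rmorphD.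
    by split=> //; exact: qD.
  - move=> g _ [a [<- na]]; have [b <-] := sur g; exists (b * a).
    by rewrite rmorphM; split=> //; exact: qM.
  - move=> [a [a1 na]]; apply: q1; apply: kerq na; by rewrite a1 rmorph1.
  - move=> g g' [a]; have [b <-] := sur g; have [b' <-] := sur g'.
    rewrite -rmorphM => -[e na].
    have [nb|nb'] : ~ unit_at b q \/ ~ unit_at b' q by apply: qP; exact: kerq na.
      by left; exists b.
    by right; exists b'.
have [u [[Wu evu] _]] := uqX _ pr.
have Vu : V (f u) by [].
have evq (a : sec Y V) : unit_at a q <-> unit_at (comorph f V a) u.
  have H : ~ unit_at (comorph f V a) u <-> ~ unit_at a q.
    rewrite -[X in X <-> _]/([set g | ~ unit_at g u] (comorph f V a)) evu /=.
    by split=> [[b [e nb]]|na]; [exact: kerq nb|exists a].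
  by split=> h; apply: contrapT => /H.
exists u; split.
  have [z [_ zu]] := uqY _ (prY q Vq).
  rewrite -(zu q) // -(zu (f u)) //; split=> //.
  by apply/seteqP; split=> a /=; rewrite evq -comorph_unit.
apply: affine_specialization affW _ _ Wu _ => g; have [a <-] := sur g.
by move=> /evq/spec; rewrite comorph_unit.
Qed.

Lemma closed_immersion_closed_point (x : X) :
  closed [set x] -> closed [set f x].
Proof.
move=> /closed1P cx; apply/closed1P => q hq; have [V [Vq affV]] := sY q.
by have [u [<- /cx ->]] := closed_immersion_specialization affV Vq hq.
Qed.

End ClosedImmersion.
End Morphism.

(** * Stalks and open subspaces *)

Section StalkMap.
Variables (K : fieldType) (X Y : kspace K) (f : morph X Y) (x : X).
Variables (L L' : comPzRingType).
Variable germ : forall U : opens X, U x -> {rmorphism sec X U -> L}.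
Variable germ' : forall U : opens Y, U (f x) -> {rmorphism sec Y U -> L'}.
Hypotheses (stL : is_stalk germ) (stL' : is_stalk germ').
Implicit Types V W : opens Y.

(** A representative of each germ is chosen. Two representatives agree near [f x], so their
    pullbacks have the same germ at [x]; the ring axioms are checked on representatives over a
    common open. *)
Lemma stalk_map_exists : exists phi : {rmorphism L' -> L},
  forall V (hV : V (f x)) s,
    phi (germ' hV s) = @germ (inverse_image f V) hV (comorph f V s).
Proof.
have ex l : exists l', exists V (hV : V (f x)) s,
    germ' hV s = l /\ l' = @germ (inverse_image f V) hV (comorph f V s).
  by have [_ gs _] := stL'; have [V [hV [s <-]]] := gs l; do 4!eexists.
have [phi phiP] := choice ex.
have phiE V (hV : V (f x)) s :
    phi (germ' hV s) = @germ (inverse_image f V) hV (comorph f V s).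
  have [W [hW [s' [e ->]]]] := phiP (germ' hV s).
  have [W' [h [h' [W'x e']]]] := germ_eq stL' e.
  have W'x' : inverse_image f W' x by [].
  rewrite -(germ_restr stL (inverse_image_mono (f := f) h) _ W'x').
  rewrite -(germ_restr stL (inverse_image_mono (f := f) h') _ W'x').
  by rewrite -!comorph_restr e'.
have two l m : exists V (hV : V (f x)) s t, l = germ' hV s /\ m = germ' hV t.
  have [_ gs _] := stL'; have [V [hV [s <-]]] := gs l; have [W [hW [t <-]]] := gs m.
  have hI : opensI V W (f x) by [].
  exists (opensI V W), hI, (restr (@opensIl _ V W) s), (restr (@opensIr _ V W) t).
  by rewrite !(germ_restr stL' _ _ hI).
have phiB : {morph phi : a b / a - b}.
  move=> l m; have [V [hV [s [t [-> ->]]]]] := two l m.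
  by rewrite -rmorphB !phiE -!rmorphB.
have phiM : {morph phi : a b / a * b}.
  move=> l m; have [V [hV [s [t [-> ->]]]]] := two l m.
  by rewrite -rmorphM !phiE -!rmorphM.
have phi1 : phi 1 = 1.
  have hW : whole Y (f x) by [].
  by rewrite -(rmorph1 (germ' hW)) phiE !rmorph1.
pose phir : {rmorphism L' -> L} := HB.pack phi
  (GRing.isZmodMorphism.Build L' L phi phiB)
  (GRing.isMonoidMorphism.Build L' L phi (conj phi1 phiM)).
by exists phir; exact: phiE.
Qed.

Variable phi : {rmorphism L' -> L}.
Hypothesis phiE : forall V (hV : V (f x)) s,
  phi (germ' hV s) = @germ (inverse_image f V) hV (comorph f V s).

Lemma stalk_map_surj : closed_immersion f -> is_scheme Y -> onto phi.
Proof.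
move=> clf sY l; have [_ gs _] := stL; have [W [hW [s <-]]] := gs l.
have Yx : whole Y (f x) by [].
have [V [h [Vx _ [a aE]]]] := closed_immersion_lift clf sY s hW Yx.
exists (germ' Vx a); rewrite phiE aE.
exact: (germ_restr stL).
Qed.

Lemma stalk_map_zero : closed_immersion f -> is_scheme Y ->
  forall V (hV : V (f x)) a, phi (germ' hV a) = 0 ->
  exists V' (h : V' `<=` V), V' (f x) /\ comorph f V' (restr h a) = 0.
Proof.
move=> clf sY V hV a; rewrite phiE => e.
have [_ _ g0] := stL; have [W [h [Wx e0]]] := g0 _ _ _ e.
have [V' [h' [V'x e' _]]] := comorph_zero_near clf sY Wx e0.
by exists V', h'.
Qed.

End StalkMap.

(** The image point is a variable [y] with [f x = y]: the type of [germ'] depends on that point,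
    which could not be rewritten afterwards. *)
Lemma closed_stalk_map (K : fieldType) (X Y : kspace K) (f : morph X Y)
    (x : X) (y : Y) (L L' : comPzRingType)
    (germ : forall U : opens X, U x -> {rmorphism sec X U -> L})
    (germ' : forall U : opens Y, U y -> {rmorphism sec Y U -> L'}) :
  is_stalk germ -> is_stalk germ' -> closed_immersion f -> is_scheme Y ->
  f x = y -> exists phi : {rmorphism L' -> L},
  [/\ forall (V : opens Y) (hV : V y) (hV' : inverse_image f V x) s,
        phi (germ' V hV s) = germ _ hV' (comorph f V s),
      onto phi &
      forall (V : opens Y) (hV : V y) a, phi (germ' V hV a) = 0 ->
        exists (V' : opens Y) (h : V' `<=` V),
          V' y /\ comorph f V' (restr h a) = 0].
Proof.
move=> stL stL' clf sY fx; case: _ / fx germ' stL' => germ' stL'.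
have [phi phiE] := stalk_map_exists stL stL'; exists phi; split.
- by move=> V hV hV' s; rewrite (Prop_irrelevance hV' hV).
- by apply: (stalk_map_surj stL phiE).
- by move=> V hV a; apply: (stalk_map_zero stL phiE).
Qed.

Section OpenSubspace.
Variables (K : fieldType) (X : kspace K) (U : opens X).

Lemma open_image_whole : open_image (whole (open_sub U)) = U.
Proof.
apply: opens_ext; apply/seteqP; split=> [_ [x _ <-]|x Ux].
  exact: set_valP.
by exists (exist _ x (mem_set Ux)) => //; rewrite set_valE.
Qed.

Lemma open_imageP (V : opens (open_sub U)) (x : open_sub U) :
  open_image V (set_val x) <-> V x.
Proof. by split=> [[y Vy /val_inj <-]|Vx]; last by exists x. Qed.

Lemma open_sub_unit (V : opens (open_sub U)) (f : sec (open_sub U) V) x :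
  unit_at f x <-> unit_at (f : sec X (open_image V)) (set_val x).
Proof.
split=> [[W [h [Wx i]]]|[W [h [Wx i]]]].
  exists (open_image W), (open_image_sub h); split=> //.
  by apply/open_imageP.
have h' : inverse_image (open_incl U) W `<=` V.
  by move=> y /h /open_imageP.
exists (inverse_image (open_incl U) W), h'; split=> //.
have hW : open_image (inverse_image (open_incl U) W) `<=` W.
  exact: incl_image.
suff -> : restr h' f = restr hW (restr h (f : sec X (open_image V))).
  exact: invertible_rmorph.
by apply/esym; exact: (@restr_comp _ X).
Qed.

Lemma affine_open_sub : affine_open U -> affine_open (whole (open_sub U)).
Proof.
rewrite -{1}open_image_whole => -[pr uq bas loc].
have evE (x : open_sub U) :
    [set f : sec (open_sub U) (whole (open_sub U)) | ~ unit_at f x] =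
    [set f : sec X (open_image (whole (open_sub U))) | ~ unit_at f (set_val x)].
  by apply/seteqP; split=> f /= nf fu; apply: nf; apply/open_sub_unit.
have img (x : open_sub U) : open_image (whole (open_sub U)) (set_val x).
  exact/open_imageP.
split.
- by move=> x _; rewrite evE; exact: pr.
- move=> p /uq[y [[[x _ <-] evx] yu]]; exists x; split; first by rewrite evE.
  move=> x' [_]; rewrite evE => ev'.
  by apply: val_inj; rewrite -!set_valE; apply: yu.
- move=> V x _ Vx.
  have [|f [[_ fx] fV]] := bas (open_image V) (set_val x) _ ((open_imageP V x).2 Vx).
    by apply: open_image_sub => ? _.
  exists f; split; first by split=> //; apply/open_sub_unit.
  move=> y [_ /open_sub_unit fy]; apply/open_imageP; apply: fV; split=> //.
- move=> f V h e; apply: (loc f (open_image V) (open_image_sub h)).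
  apply/seteqP; split=> [_ [y Vy <-]|y [[z _ <-] fz]].
    move: Vy; rewrite e => -[_ fy]; split; first exact: img.
    exact/open_sub_unit.
  by exists z => //; rewrite e; split=> //; apply/open_sub_unit.
Qed.

Section Stalk.
Variables (x : open_sub U) (L : comPzRingType).
Variable germ : forall V : opens X, V (set_val x) -> {rmorphism sec X V -> L}.
Hypothesis stL : is_stalk germ.

Definition open_sub_germ (V : opens (open_sub U)) (hV : V x) :
    {rmorphism sec (open_sub U) V -> L} :=
  @germ (open_image V) ((open_imageP V x).2 hV).

Lemma open_sub_stalk : is_stalk open_sub_germ.
Proof.
have [gr gs g0] := stL; split.
- by move=> V W h hV hW s; exact: gr.
- move=> l; have [V [hV [s <-]]] := gs l.
  exists (inverse_image (open_incl U) V), hV, (comorph (open_incl U) V s).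
  exact: gr.
- move=> V hV s /g0[W [h [Wx e]]].
  have h' : inverse_image (open_incl U) W `<=` V by move=> y /h/open_imageP.
  exists (inverse_image (open_incl U) W), h'; split=> //.
  have hW : open_image (inverse_image (open_incl U) W) `<=` W by exact: incl_image.
  have := congr1 (restr hW) e; rewrite rmorph0 => <-.
  by apply/esym; exact: (@restr_comp _ X).
Qed.

End Stalk.
End OpenSubspace.

(** * The reduction of a Cohen-Macaulay curve *)

(** The [d + 1] powers of [a] up to [a ^+ d] are linearly dependent; one solves for the lowest power
    with a nonzero coefficient. The relation reads [a^k (1 - a r(a)) = 0]. *)
Lemma algebraic_power (K : fieldType) (D : comPzRingType)
    (phi : {rmorphism K -> D}) (d : nat) (a : D) :
  free_quotient phi [set 0] d ->
  exists k m (r : nat -> K), a ^+ k = \sum_(j < m) phi (r j) * a ^+ (j + k.+1).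
Proof.
move=> [e he].
have co (j : nat) : exists c : {ffun 'I_d -> K}, a ^+ j = \sum_i phi (c i) * e i.
  by have [c [/= cE _]] := he (a ^+ j); exists c; exact: subr0_eq.
have [c cE] := choice co.
pose M := \matrix_(j < d.+1, i < d) c j i.
have /rowV0Pn[v /sub_kermxP vM vn0] : kermx M != 0.
  by rewrite kermx_eq0 /row_free ltn_eqF // ltnS rank_leq_col.
pose w (j : nat) : K := if insub j is Some i then v 0 i else 0.
have wE (j : 'I_d.+1) : w j = v 0 j by rewrite /w valK.
have w0 : \sum_(0 <= j < d.+1) phi (w j) * a ^+ j = 0.
  rewrite big_mkord; under eq_bigr do rewrite cE mulr_sumr.
  rewrite exchange_big big1 // => i _.
  under eq_bigr do rewrite mulrA -rmorphM.
  rewrite -mulr_suml -rmorph_sum; have := congr1 (fun A : 'rV_d => A 0 i) vM.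
  rewrite !mxE => s0; rewrite [X in phi X](_ : _ = 0) ?rmorph0 ?mul0r //.
  by rewrite -[RHS]s0; apply: eq_bigr => j _; rewrite wE mxE.
have [k [kd wk wlt]] : exists k, [/\ (k < d.+1)%N, w k != 0 &
    forall j, (j < k)%N -> w j = 0].
  have ex : exists k, w k != 0.
    move: vn0 => /eqP vn0; apply: contrapT => H; apply: vn0; apply/rowP => j.
    by rewrite mxE -wE; apply: contrapT => /eqP wj; apply: H; exists j.
  case: (ex_minnP ex) => k wk kmin; exists k.
  split=> [||j] //; first by move: wk; rewrite /w; case: insubP => //; rewrite eqxx.
  by rewrite ltnNge; apply: contraNeq => /kmin.
(* The remaining exponents run from [k + 1] to [d]. *)
exists k, (d - k)%N, (fun j => - (w k)^-1 * w (j + k.+1)%N).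
move: w0; rewrite (big_cat_nat_idem _ (n := k)) //=; last by rewrite ltnW.
  rewrite big_nat big1 ?add0r => [|j /andP[_ /wlt ->]]; last by rewrite rmorph0 mul0r.
  rewrite big_ltn // -(add0n k.+1) big_addn subSS big_mkord => /eqP.
  rewrite addr_eq0 => /eqP /(congr1 (fun x => phi (w k)^-1 * x)).
  rewrite mulrA -rmorphM mulVf // rmorph1 mul1r add0n => ->.
  rewrite mulrN mulr_sumr -sumrN; apply: eq_bigr => j _.
  by rewrite mulNr rmorphN rmorphM mulNr mulrA.
exact: addr0.
Qed.

Section Reduction.
Variables (K : fieldType) (Y C : kspace K) (c : morph C Y).
Hypotheses (cmY : cohen_macaulay Y) (smC : smooth_of_dim C 1).
Hypotheses (irrC : irreducible C) (redc : is_reduction c).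

Let sY : is_scheme Y. Proof. by case: cmY. Qed.
Let sC : is_scheme C. Proof. by case: smC. Qed.
Let clc : closed_immersion c. Proof. by case: redc. Qed.

Lemma reduction_kernel_nonunit (V : opens Y) (g : sec Y V) y :
  comorph c V g = 0 -> V y -> ~ unit_at g y.
Proof.
move=> g0 Vy; have [_ _ sur] := redc; have [x cx] := sur y.
move: Vy; rewrite -cx => Vx; rewrite -comorph_unit // g0.
exact: scheme_unit0.
Qed.

(** Clearing a denominator extends [g] to [V]. The pullback of the numerator to [C] vanishes only
    where [t] is a unit, so a further power of [t] is needed to kill it. *)
Lemma extend_kernel_section (V W : opens Y) (g : sec Y W) y :
  affine_open V -> V y -> W y -> comorph c W g = 0 ->
  exists (t b : sec Y V) (m : nat) (hW : basic t `<=` W),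
    [/\ unit_at t y, comorph c V b = 0 &
        restr (@basic_sub _ _ _ t) b =
        restr (@basic_sub _ _ _ t) t ^+ m * restr hW g].
Proof.
move=> affV Vy Wy g0; have [t [ty tW]] := affine_nbhd affV Vy Wy.
have [a [m aE]] := affine_frac affV (@basic_sub _ _ _ t) (restr tW g) erefl.
have [affcV _] := clc affV.
have D : basic (comorph c V t) `<=` inverse_image c (basic t).
  by rewrite inverse_image_basic.
have [k kE] : exists k, comorph c V t ^+ k * comorph c V a = 0.
  apply: (affine_kill affcV).
  have hb := inverse_image_mono (f := c) (@basic_sub _ _ _ t).
  rewrite -(restr_comp hb D) -(comorph_restr (@basic_sub _ _ _ t)) -aE rmorphM.
  by rewrite (comorph_restr _ (inverse_image_mono tW)) g0 rmorph0 mulr0 rmorph0.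
exists t, (t ^+ k * a), (k + m)%N, tW; split=> //.
  by rewrite rmorphM rmorphXn.
by rewrite rmorphM -aE rmorphXn mulrA exprD.
Qed.

(** Up to a unit, the germ extends to a section on an affine open that vanishes on [C]. As [c] is
    onto on points, this section is nowhere a unit, hence nilpotent. *)
Lemma reduction_nil_kernel (y : Y) (LC LY : comPzRingType)
    (germY : forall U : opens Y, U y -> {rmorphism sec Y U -> LY})
    (psi : {rmorphism LY -> LC}) :
  is_stalk germY ->
  (forall (V : opens Y) (hV : V y) a, psi (germY V hV a) = 0 ->
    exists (V' : opens Y) (h : V' `<=` V),
      V' y /\ comorph c V' (restr h a) = 0) -> nil_kernel psi.
Proof.
move=> stY psi0 l; have [_ gs _] := stY; have [W [Wy [g <-]]] := gs l.
move=> /psi0[W' [h [W'y g0]]].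
have [V [Vy affV]] := sY y.
have [t [b [m [hW [ty b0 bE]]]]] := extend_kernel_section affV Vy W'y g0.
have [j bj] : exists j, b ^+ j = 0.
  apply: affine_nilpotent => // z Vz; exact: reduction_kernel_nonunit.
have ty' : basic t y by apply/basicP.
have ti : invertible (germY _ Vy t) by apply/(germ_unit stY).
exists j; apply: (@invertible_cancel _ ((germY _ Vy t ^+ m) ^+ j)).
  by do 2!apply: invertibleX.
rewrite -exprMn -(germ_restr stY h _ W'y) -(germ_restr stY hW _ ty').
rewrite -(germ_restr stY (@basic_sub _ _ _ t) _ ty') -rmorphXn -rmorphM -bE.
by rewrite (germ_restr stY _ Vy) -rmorphXn bj rmorph0.
Qed.

(** By irreducibility and the absence of embedded points, an ideal of [C] that is zero at one point
    is zero everywhere. *)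
Lemma reduction_kernel_stalk (p : C) (W0 : opens Y) (g0 : sec Y W0) :
  comorph c W0 g0 = 0 -> g0 <> 0 ->
  exists (V : opens Y) (g : sec Y V),
    [/\ V (c p), comorph c V g = 0 &
        forall (V' : opens Y) (h : V' `<=` V), V' (c p) -> restr h g <> 0].
Proof.
move=> cg0 g0n0; apply: contrapT => H.
have H0 (V : opens Y) (g : sec Y V) : V (c p) -> comorph c V g = 0 ->
    exists (V' : opens Y) (h : V' `<=` V), V' (c p) /\ restr h g = 0.
  move=> Vp cg; apply: contrapT => nz; apply: H; exists V, g; split=> // V' h V'p e.
  by apply: nz; exists V', h.
apply: g0n0; apply: sec_local => y Wy.
have [_ _ sur] := redc; have [x cx] := sur y.
have [_ irr] := irrC.
(* The regularity argument needs a closed point. Each neighbourhood of [c x0] contains [y], so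
   vanishing near [c x0] is enough. *)
have [x0 [clx0 genx]] : exists x0 : C, closed [set x0] /\
    forall W : opens C, W x0 -> W x.
  by apply: closed_point_exists => //; case: smC => _ [].
have [V [Vx0 affV]] := sY (c x0).
have Vy : V y by rewrite -cx; exact: (genx (inverse_image c V)).
have [t [b [m [hW [ty b0 bE]]]]] := extend_kernel_section affV Vy Wy cg0.
suff [V1 [h1 [V1x0 bV1]]] :
    exists (V1 : opens Y) (h : V1 `<=` V), V1 (c x0) /\ restr h b = 0.
  have hI : opensI (basic t) V1 `<=` basic t by exact: opensIl.
  exists (opensI (basic t) V1), (subset_trans hI hW); split.
    by split; [apply/basicP|rewrite -cx; apply: (genx (inverse_image c V1))].
  rewrite rmorph0 -(restr_comp hW hI).
  apply: (@invertible_cancel _ (restr hI (restr (@basic_sub _ _ _ t) t) ^+ m)).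
    by apply: invertibleX; apply: invertible_rmorph; exact: basic_invertible.
  rewrite -rmorphXn -rmorphM -bE.
  rewrite (restr_comp _ _ (subset_trans (@opensIr _ (basic t) V1) h1)).
  by rewrite -(restr_comp h1 (@opensIr _ (basic t) V1)) bV1 rmorph0.
(* [b] is carried to an affine neighbourhood of [c p], where it has zero germ by assumption; hence
   [b] vanishes on a nonempty open [O]. *)
have [U' [U'p affU']] := sY (c p).
have [w [Vw U'w]] := irr (inverse_image c V) (inverse_image c U')
  (ex_intro _ x0 Vx0) (ex_intro _ p U'p).
have hVU := @opensIl _ V U'.
have b0' : comorph c (opensI V U') (restr hVU b) = 0.
  by rewrite (comorph_restr _ (inverse_image_mono hVU)) b0 rmorph0.
have [t' [b' [m' [hW' [t'w b'0 b'E]]]]] :=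
  extend_kernel_section affU' U'w (conj Vw U'w : opensI V U' (c w)) b0'.
have [V' [h' [V'p b'V']]] := H0 _ _ U'p b'0.
have [w' [V'w' t'w']] := irr (inverse_image c V') (inverse_image c (basic t'))
  (ex_intro _ p V'p) (ex_intro _ w ((basicP t' (c w)).2 t'w)).
pose O := opensI V' (basic t').
have hO : O `<=` basic t' by exact: opensIr.
have hOV : O `<=` V := subset_trans (subset_trans hO hW') hVU.
have bO : restr hOV b = 0.
  apply: (@invertible_cancel _ (restr hO (restr (@basic_sub _ _ _ t') t') ^+ m')).
    by apply: invertibleX; apply: invertible_rmorph; exact: basic_invertible.
  rewrite -(restr_comp hVU (subset_trans hO hW')) -(restr_comp hW' hO).
  rewrite -rmorphXn -rmorphM -b'E.
  rewrite (restr_comp _ _ (subset_trans (@opensIl _ V' (basic t')) h')).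
  by rewrite -(restr_comp h' (@opensIl _ V' (basic t'))) b'V' rmorph0.
have Ow' : O (c w') by split.
have [s [sw' sO]] := affine_nbhd affV (hOV _ Ow') Ow'.
have [k sk] : exists k, s ^+ k * b = 0.
  by apply: affine_kill => //; rewrite -(restr_comp hOV sO) bO rmorph0.
have [_ _ regC] := smC; have [LC [germC [stC rC]]] := regC _ clx0.
have [_ cmat] := cmY; have [LY [germY [stY cY]]] := cmat (c x0).
have [psi [psiE spsi psi0]] := closed_stalk_map stC stY clc sY erefl.
(* [s] is a unit on an open that meets every neighbourhood of [x0] in [C], so [s ^+ k] has nonzero
   image in [LC]. It is thus regular in [LY], and it kills [b]. *)
have bg0 : germY V Vx0 b = 0.
  apply: (cm_regular cY rC spsi (h := germY V Vx0 (s ^+ k))).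
  - by apply: (reduction_nil_kernel stY psi0).
  - move=> /psi0[V2 [h2 [V2x0 e]]].
    have [w2 [V2w2 sw2]] := irr (inverse_image c V2) (inverse_image c (basic s))
      (ex_intro _ x0 V2x0) (ex_intro _ w' ((basicP s (c w')).2 sw')).
    apply: (reduction_kernel_nonunit e V2w2); rewrite unit_at_restr //.
    elim: (k) => [|j IH]; last by rewrite exprS; apply/unit_atM; split=> //; case: sw2.
    apply: invertible_unit_at; first exact: (h2).
    by exists 1; rewrite mulr1.
  - by rewrite -rmorphM sk rmorph0.
have [_ _ z0] := stY; exact: z0 bg0.
Qed.

End Reduction.

(** * The ideal of U in S at the support of Z *)

Section SupportPoint.
Variables (K : fieldType) (Y C S Z : kspace K) (c : morph C Y) (U : opens Y).
Variables (k : morph (open_sub U) S) (z : morph Z (open_sub U)).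
Variables (d : nat) (P : open_sub U).
Hypotheses (cmY : cohen_macaulay Y) (smC : smooth_of_dim C 1).
Hypotheses (irrC : irreducible C) (redc : is_reduction c).
Hypotheses (affU : affine_open U) (surfS : smooth_affine_surface S).
Hypotheses (clk : closed_immersion k) (clz : closed_immersion z).
Hypotheses (lenZ : has_length Z d) (suppZ : range z = [set P]).
Hypothesis ZC : contained_in z c.

Let sY : is_scheme Y. Proof. by case: cmY. Qed.
Let sC : is_scheme C. Proof. by case: smC. Qed.
Let sS : is_scheme S. Proof. by case: surfS => _ []. Qed.
Let clc : closed_immersion c. Proof. by case: redc. Qed.

Lemma support_point x : z x = P.
Proof. by have : range z (z x) by [exists x]; rewrite suppZ. Qed.

Lemma support_nonempty : exists x, z x = P.
Proof. by have : [set P] P by []; rewrite -suppZ => -[x _ <-]; exists x. Qed.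

Lemma affine_support : affine_open (inverse_image z (whole (open_sub U))).
Proof. by have [] := clz (affine_open_sub affU). Qed.

Lemma vanishing_nonunit (V : opens (open_sub U)) (g : sec (open_sub U) V) :
  V P -> comorph z V g = 0 -> ~ unit_at g P.
Proof.
have [x zx] := support_nonempty; rewrite -zx => Vx g0.
rewrite -comorph_unit // g0 => u0.
have hI := @opensIl _ (inverse_image z V) (inverse_image z (whole (open_sub U))).
have hI' := @opensIr _ (inverse_image z V) (inverse_image z (whole (open_sub U))).
have Ix : opensI (inverse_image z V) (inverse_image z (whole (open_sub U))) x by [].
apply: (affine_unit0 affine_support (x := x)) => //.
rewrite -(unit_at_restr hI') // rmorph0 -(rmorph0 (restr hI)).
exact/unit_at_restr.
Qed.

(* Otherwise p would be the generic point of C, at which a uniformizer tau of a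
   closed specialization x0 of p is invertible; but, O(Z) being finite over K,
   a relation a^k (1 - a r(a)) = 0 holds on Z for a lift a of tau, whereas
   1 - a r(a) is invertible near x0.                                         *)
Lemma support_closed_in_reduction (p : C) : c p = set_val P -> closed [set p].
Proof.
move=> cp; have [x0 [clx0 genp]] : exists x0 : C, closed [set x0] /\
    forall W : opens C, W x0 -> W p.
  by apply: closed_point_exists => //; case: smC => _ [].
have [-> //|px0] := pselect (p = x0).
have [_ _ regC] := smC; have [L [germ [stL rL]]] := regC _ clx0.
have [t [nt _ gen _]] := regular_local1_uniformizer rL.
have [_ gs _] := stL; have [W0 [W0x [tau tauE]]] := gs t.
(* If [tau] were a nonunit at [p], every section that is a nonunit at [x0], a multiple of [tau] near
   it, would be a nonunit at [p]; then [p] and [x0] would lie in the same opens. *)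
have taup : unit_at tau p.
  apply: contrapT => ntau; apply: px0; apply: scheme_T0 => //.
  have [V [Vx0 affV]] := sC x0.
  have Vp : V p by exact: genp.
  apply: affine_specialization affV _ _ Vp _ => f fp.
  apply: contrapT => nf; have [y yE] : exists y, germ V Vx0 f = y * t.
    by apply: gen => /(germ_unit stL).
  have [W [Wx [eta etaE]]] := gs y.
  have hI : opensI W W0 x0 by [].
  have e : germ V Vx0 f = germ _ hI
      (restr (@opensIl _ W W0) eta * restr (@opensIr _ W W0) tau).
    by rewrite rmorphM !(germ_restr stL _ _ hI) yE etaE tauE.
  have [W' [h [h' [W'x e']]]] := germ_eq stL e.
  have W'p : W' p by exact: genp.
  have : unit_at (restr h f) p by apply/unit_at_restr.
  rewrite e' unit_at_restr // => /unit_atM[_].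
  by rewrite unit_at_restr //; case: (h' _ W'p).
have [V [hV [Vx0 _ [a aE]]]] := closed_immersion_lift clc sY tau W0x
  (I : whole Y (c x0)).
have VP : V (set_val P) by rewrite -cp; exact: (genp (inverse_image c V)).
pose incl := open_incl U.
(* All of [Z] maps to [P], which lies in [V], so sections over [V] pull back to global sections of
   [Z]. *)
have hZ : whole Z `<=` inverse_image z (inverse_image incl V).
  by move=> x _; rewrite /= /open_preimage /= support_point.
pose rho : {rmorphism sec Y V -> sec Z (whole Z)} :=
  GRing.RMorphism.clone _ _ (restr hZ \o comorph z _ \o comorph incl V) _.
have rhoE b : rho b = restr hZ (comorph z _ (comorph incl V b)) by [].
have [j [m [r rE]]] := algebraic_power (rho a) lenZ.
pose q := \sum_(i < m) base_scalar V (r i) * a ^+ i.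
pose e := a ^+ j * (1 - a * q).
have e0 : rho e = 0.
  rewrite /e /q mulrBr mulr1 rmorphB rmorphXn rE mulr_sumr mulr_sumr rmorph_sum.
  rewrite -sumrB big1 // => i _; apply/eqP; rewrite subr_eq0; apply/eqP.
  rewrite !rmorphM !rmorphXn [rho (base_scalar _ _)]rhoE !comorph_scalar.
  rewrite /base_scalar (restr_comp _ _ (@subset_refl _ (whole Z))) restr_id.
  by rewrite exprD exprS; ring.
have : ~ unit_at (comorph incl V e) P.
  apply: vanishing_nonunit => //.
  apply: (can_inj (restr_cancel hZ (@subsetT _ _))).
  by rewrite rmorph0 -rhoE.
case; apply/comorph_unit => //; rewrite -[mfun incl P]/(set_val P) -cp -comorph_unit; last by rewrite cp.
rewrite /e rmorphM; apply/unit_atM; split.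
  rewrite rmorphXn aE -rmorphXn unit_at_restr; last exact: genp.
  elim: (j) => [|i IH]; last by rewrite exprS; apply/unit_atM.
  apply: invertible_unit_at; first exact: genp.
  by exists 1; rewrite mulr1.
rewrite rmorphB rmorph1 rmorphM aE.
set u := 1 - _.
have ux0 : unit_at u x0.
  apply/(germ_unit stL (Vx0 : inverse_image c V x0)).
  rewrite rmorphB rmorph1 rmorphM (germ_restr stL hV W0x) tauE.
  apply: local_ring_sub1; first by case: rL.
  by move=> /invertible_factor.
by have [] : basic u p by apply: genp; apply/basicP.
Qed.

Lemma support_in_reduction : exists p, c p = set_val P.
Proof. by have [_ _] := redc; apply. Qed.

Lemma support_closed : closed [set set_val P].
Proof.
have [p cp] := support_in_reduction; rewrite -cp.
by apply: (closed_immersion_closed_point clc) => //; exact: support_closed_in_reduction.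
Qed.

Lemma support_closed_in_open : closed [set P].
Proof.
apply/closed1P => q hq; apply: val_inj; rewrite -!set_valE.
apply: ((closed1P _).1 support_closed) => V Vq.
by have := hq (inverse_image (open_incl U) V) Vq.
Qed.

Lemma support_closed_in_surface : closed [set k P].
Proof.
by apply: (closed_immersion_closed_point clk) => //; exact: support_closed_in_open.
Qed.

(** Turns [contained_in], which speaks of opens of [Y], into a statement on neighbourhoods of [k P]
    in [S]. *)
Lemma reduction_vanishes_on_support (V : opens S) (g : sec S V)
    (W : opens Y) (h : W `<=` open_image (inverse_image k V)) :
  V (k P) -> W (set_val P) ->
  comorph c W (restr h (comorph k V g)) = 0 ->
  exists (V' : opens S) (h' : V' `<=` V),
    V' (k P) /\ comorph z _ (comorph k V' (restr h' g)) = 0.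
Proof.
move=> VP WP /ZC; set g' := comorph (open_incl U) W _ => g'0.
have WP' : inverse_image (open_incl U) W P by [].
have [V' [V'P V'V V'W]] := closed_immersion_nbhd clk sS WP' VP.
exists V', V'V; split=> //.
suff -> : comorph k V' (restr V'V g) = restr V'W g'.
  rewrite (comorph_restr V'W (inverse_image_mono (f := z) V'W)).
  by rewrite g'0 rmorph0.
rewrite (comorph_restr _ (inverse_image_mono V'V)).
set G : sec Y (open_image (inverse_image k V)) := comorph k V g.
have hs := open_image_sub (inverse_image_mono (f := k) V'V).
have h1 := open_image_sub V'W.
have h2 : open_image (inverse_image (open_incl U) W) `<=` W by exact: incl_image.
transitivity (restr hs G).
  exact: (congr1 (fun h => restr h G) (Prop_irrelevance _ _)).
transitivity (restr h1 (restr h2 (restr h G))).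
  by rewrite (restr_comp _ _ (subset_trans h1 h2)) (restr_comp _ _ hs).
rewrite (Prop_irrelevance h1 (open_image_sub V'W)).
by rewrite (Prop_irrelevance h2 (incl_image (V := W))).
Qed.

Hypothesis nonreduced : exists (W : opens Y) (g : sec Y W),
  comorph c W g = 0 /\ g <> 0.

(** The factorization is found in the local ring at [k P] and spread out to a neighbourhood. The
    factors vanish on [C] near [P], hence on [Z]. *)
Lemma surface_kernel_square (V : opens S) (g : sec S V) :
  V (k P) -> comorph k V g = 0 ->
  exists (V' : opens S) (h : V' `<=` V) (f1 f2 : sec S V'),
    [/\ V' (k P), restr h g = f1 * f2, comorph z _ (comorph k V' f1) = 0 &
        comorph z _ (comorph k V' f2) = 0].
Proof.
move=> VP g0; have [p cp] := support_in_reduction.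
have [_ _ regC] := smC.
have [LC [germC [stC rC]]] := regC _ (support_closed_in_reduction cp).
have [_ cmat] := cmY; have [LY [germY [stY cY]]] := cmat (set_val P).
have [_ [_ _ regS]] := surfS.
have [LS [germS [stS rS]]] := regS _ support_closed_in_surface.
have [psi [psiE spsi psi0]] := closed_stalk_map stC stY clc sY cp.
have stU := open_sub_stalk stY.
have [phi [phiE sphi phi0]] := closed_stalk_map stU stS clk sS erefl.
have [W0 [g0' [cg0 g0n]]] := nonreduced.
have kerY : exists a, psi a = 0 /\ a <> 0.
  have [V0 [a [V0P a0 an0]]] := reduction_kernel_stalk cmY smC irrC redc p cg0 g0n.
  have V0P' : V0 (set_val P) by rewrite -cp.
  exists (germY V0 V0P' a); split; first by rewrite (psiE _ _ V0P) a0 rmorph0.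
  move=> e; have [_ _ gz] := stY; have [V' [h [V'P e']]] := gz _ _ _ e.
  by apply: (an0 V' h) => //; rewrite cp.
have gk : phi (germS V VP g) = 0 by rewrite (phiE _ _ VP) g0 rmorph0.
have [l1 [l2 [l10 l20 lE]]] := kernel_in_square rS cY rC sphi spsi
  (reduction_nil_kernel cmY smC redc stY psi0) kerY gk.
have lift l : psi (phi l) = 0 -> exists (V1 : opens S) (V1P : V1 (k P)) f,
    germS V1 V1P f = l /\ comorph z _ (comorph k V1 f) = 0.
  have [_ gs _] := stS; have [V1 [V1P [f <-]]] := gs l.
  rewrite (phiE _ _ V1P) /open_sub_germ => /psi0[W [h [WP e]]].
  have [V' [h' [V'P e']]] := reduction_vanishes_on_support V1P WP e.
  by exists V', V'P, (restr h' f); split=> //; apply: (germ_restr stS).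
have [V1 [V1P [f1 [f1E f10]]]] := lift _ l10.
have [V2 [V2P [f2 [f2E f20]]]] := lift _ l20.
have hI : opensI V1 V2 (k P) by [].
have h1 := @opensIl _ V1 V2; have h2 := @opensIr _ V1 V2.
have e : germS V VP g = germS _ hI (restr h1 f1 * restr h2 f2).
  by rewrite rmorphM !(germ_restr stS _ _ hI) f1E f2E.
have [W [h [h' [WP e']]]] := germ_eq stS e.
exists W, h, (restr h' (restr h1 f1)), (restr h' (restr h2 f2)); split=> //.
- by rewrite e' rmorphM.
- have hW := subset_trans h' h1; rewrite (restr_comp _ _ hW).
  rewrite (comorph_restr _ (inverse_image_mono hW)).
  rewrite (comorph_restr _
    (inverse_image_mono (f := z) (inverse_image_mono (f := k) hW))).
  by rewrite f10 rmorph0.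
- have hW := subset_trans h' h2; rewrite (restr_comp _ _ hW).
  rewrite (comorph_restr _ (inverse_image_mono hW)).
  rewrite (comorph_restr _
    (inverse_image_mono (f := z) (inverse_image_mono (f := k) hW))).
  by rewrite f20 rmorph0.
Qed.

(** As [Z] maps to [P], vanishing on [Z] can be tested on any neighbourhood of [k P]. *)
Lemma global_vanishing (V : opens S) (g : sec S (whole S)) (h : V `<=` whole S) :
  V (k P) -> comorph z _ (comorph k V (restr h g)) = 0 <->
  global_comorph z (global_comorph k g) = 0.
Proof.
move=> VP; have hU : inverse_image k V `<=` whole (open_sub U) by [].
have hZ : inverse_image z (inverse_image k V) `<=` whole Z by [].
have hZ' : whole Z `<=` inverse_image z (inverse_image k V).
  by move=> x _; rewrite /= /open_preimage /= support_point.
rewrite -(global_comorphE _ h hU) -(global_comorphE _ hU hZ).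
split=> [e|->]; last by rewrite rmorph0.
by apply: (can_inj (restr_cancel hZ hZ')); rewrite e rmorph0.
Qed.

(** Clearing denominators in the local factorization gives [s^N g = s^j a1 a2] with [a1], [a2]
    vanishing on [Z] and [s] a unit at [k P]. Since [s] is invertible on [Z], it has an inverse [s']
    modulo the ideal of [Z] in [S]. *)
Lemma surface_kernel_square_global g : global_comorph k g = 0 ->
  let J := subscheme_ideal z in exists a1 b1 a2 b2,
    [/\ J (global_comorph k a1) /\ J (global_comorph k b1),
        J (global_comorph k a2) /\ J (global_comorph k b2) &
        g = a1 * b1 + a2 * b2].
Proof.
move=> g0 J; have [affS _] := surfS.
have affZ := affine_open_sub affU.
have SP : whole S (k P) by [].
have kg0 : comorph k (whole S) g = 0.
  have hU : inverse_image k (whole S) `<=` whole (open_sub U) by [].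
  rewrite -[g](restr_id (@subset_refl _ (whole S))) -(global_comorphE _ _ hU).
  by rewrite g0 rmorph0.
have [V [h [f1 [f2 [VP gE f10 f20]]]]] := surface_kernel_square SP kg0.
have [s [sP sV]] := affine_nbhd affS SP VP.
have hs := @basic_sub _ _ _ s.
have sP' : basic s (k P) by apply/basicP.
have lift f : comorph z _ (comorph k V f) = 0 -> exists m a,
    J (global_comorph k a) /\ restr hs s ^+ m * restr sV f = restr hs a.
  move=> f0; have [a [m aE]] := affine_frac affS hs (restr sV f) erefl.
  exists m, a; split=> //; apply/(global_vanishing _ hs sP').
  rewrite -aE !rmorphM (comorph_restr sV (inverse_image_mono sV)).
  rewrite (comorph_restr (inverse_image_mono sV)
    (inverse_image_mono (f := z) (inverse_image_mono (f := k) sV))).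
  by rewrite f0 rmorph0 mulr0.
have [m1 [a1 [Ja1 a1E]]] := lift _ f10.
have [m2 [a2 [Ja2 a2E]]] := lift _ f20.
have [j jE] : exists j, s ^+ j * (s ^+ (m1 + m2) * g - a1 * a2) = 0.
  apply: (affine_kill affS).
  rewrite (Prop_irrelevance (@basic_sub _ _ _ s) hs) rmorphB !rmorphM -a1E -a2E.
  have -> : restr hs g = restr sV f1 * restr sV f2.
    by rewrite -rmorphM -gE (restr_comp _ _ hs).
  by rewrite rmorphXn exprD; ring.
have JE a : J a = (global_comorph z a = 0) by [].
pose rho a := global_comorph z (global_comorph k a).
have [s' s'E] : exists s', rho (1 - s * s') = 0.
  have [l lE] : invertible (global_comorph z (global_comorph k s)).
    apply: invertible_local => x _.
    have hk : inverse_image k (whole S) `<=` whole (open_sub U) by [].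
    have hz : inverse_image z (inverse_image k (whole S)) `<=` whole Z by [].
    rewrite -(unit_at_restr hz) // (global_comorphE _ hk hz).
    rewrite (global_comorphE _ (@subset_refl _ (whole S))) restr_id.
    by rewrite !comorph_unit // support_point.
  have [b bE] := global_comorph_onto affZ clz l.
  have [s' s'E] := global_comorph_onto affS clk b.
  by exists s'; rewrite /rho !(rmorphB, rmorphM, rmorph1) s'E bE lE subrr.
pose N := (j + (m1 + m2))%N.
(* [g] is [s'^N s^N g] plus [(1 - s^N s'^N) g]; in the second product both factors vanish on [Z],
   since [g] already vanishes on [U]. *)
exists (s' ^+ N * s ^+ j * a1), a2, (1 - s ^+ N * s' ^+ N), g; split.
- by split=> //; rewrite JE !rmorphM [global_comorph z (global_comorph k a1)]Ja1 mulr0.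
- split; rewrite JE; last by rewrite g0 rmorph0.
  move: s'E; rewrite /rho !(rmorphB, rmorphM, rmorph1, rmorphXn) -exprMn.
  by move=> /subr0_eq <-; rewrite expr1n subrr.
- move: jE; rewrite mulrBr mulrA -exprD -/N => /subr0_eq e.
  have -> : s' ^+ N * s ^+ j * a1 * a2 = s' ^+ N * (s ^+ N * g) by rewrite e; ring.
  ring.
Qed.

End SupportPoint.

(** * Tangent spaces of Hilbert schemes *)

Section DualMap.
Variables (A B : comPzRingType) (f : {rmorphism A -> B}).

Lemma dual_map_is_zmod_morphism : {morph @dual_map A B f : x y / x - y}.
Proof. by move=> x y; congr (_, _); rewrite /= rmorphB. Qed.

Lemma dual_map_is_monoid_morphism :
  @dual_map A B f 1 = 1 /\ {morph @dual_map A B f : x y / x * y}.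
Proof.
split; first by congr (_, _); rewrite /= ?rmorph1 ?rmorph0.
by move=> x y; congr (_, _); rewrite /= ?rmorphD !rmorphM.
Qed.

Definition dual_rmorph : {rmorphism dual A -> dual B} :=
  HB.pack (@dual_map A B f)
    (GRing.isZmodMorphism.Build (dual A) (dual B) (dual_map f)
       dual_map_is_zmod_morphism)
    (GRing.isMonoidMorphism.Build (dual A) (dual B) (dual_map f)
       dual_map_is_monoid_morphism).

Lemma dual_rmorphE : dual_rmorph = dual_map f :> (dual A -> dual B).
Proof. by []. Qed.

End DualMap.

Section HilbertTangent.
Variables (K : fieldType) (A B : comPzRingType).
Variables (iota : {rmorphism K -> A}) (kappa : {rmorphism K -> B}).
Variables (f : {rmorphism A -> B}) (d : nat) (J : set B).
Hypotheses (ontof : onto f) (fiota : forall x, f (iota x) = kappa x).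
Hypothesis ker_square : forall g, f g = 0 -> exists a1 b1 a2 b2,
  [/\ J (f a1) /\ J (f b1), J (f a2) /\ J (f b2) & g = a1 * b1 + a2 * b2].

Let F := dual_rmorph f.

Lemma dual_map_onto : onto F.
Proof.
move=> [b1 b2]; have [a1 <-] := ontof b1; have [a2 <-] := ontof b2.
by exists (a1, a2).
Qed.

(* Flatness over K[eps]: the multiples of eps in L are those of the fibre.   *)
Lemma tangent_flat (I : set A) L : hilb_tangent iota d I L ->
  forall b, L ((0, b) : dual A) <-> I b.
Proof.
move=> [[L0 LD LM] [e he] <-] b.
have epsE (x : dual A) : ((0, 1) : dual A) * x = (0, x.1).
  by congr (_, _) => /=; ring.
split=> [Lb|[x Lx <-]]; last by rewrite -epsE; exact: LM.
(* Expand [b] modulo [L] and multiply by eps: as [b eps] is in [L], uniqueness of coordinates makes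
   every [c i] a multiple of eps, so the element of [L] thus obtained reduces to [b]. *)
have [c [cL _]] := he (b, 0).
have zero_comb (s : {ffun 'I_d -> dual K}) :
    L (\sum_i dual_map iota (s i) * e i) -> s = [ffun=> 0].
  move=> Ls; have [s0 [_ s0u]] := he 0.
  rewrite -(s0u s) ?sub0r; last by rewrite -mulN1r; exact: LM.
  apply: s0u; rewrite big1 ?subr0 // => i _.
  by rewrite ffunE [dual_map iota 0](rmorph0 (dual_rmorph iota)) mul0r.
have c0 : [ffun i => ((0, (c i).1) : dual K)] = [ffun=> 0].
  apply: zero_comb.
  have -> : \sum_i dual_map iota ([ffun i => ((0, (c i).1) : dual K)] i) * e i =
      (0, b) - ((0, 1) : dual A) * ((b, 0) - \sum_i dual_map iota (c i) * e i).
    rewrite mulrBr epsE opprB addrC subrK mulr_sumr; apply: eq_bigr => i _.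
    rewrite ffunE mulrA; congr (_ * _); congr (_, _) => /=; last by ring.
    by rewrite rmorph0 mul0r.
  apply: (LD) => //; rewrite -mulN1r; apply: (LM); exact: LM.
exists ((b, 0) - \sum_i dual_map iota (c i) * e i) => //=.
have -> : (\sum_i dual_map iota (c i) * e i).1 = 0.
  elim/big_ind: _ => // [x y x0 y0|i _]; first by rewrite /= x0 y0 addr0.
  have := congr1 (fun s : {ffun 'I_d -> dual K} => (s i).2) c0.
  by rewrite !ffunE /= => ->; rewrite rmorph0 mul0r.
by rewrite oppr0 addr0.
Qed.

Lemma dual_kernel_sub L x : hilb_tangent iota d (f @^-1` J) L -> F x = 0 -> L x.
Proof.
move=> tL; have flat := tangent_flat tL.
have [[L0 LD LM] _ LE] := tL.
have sq a b : J (f a) -> J (f b) -> L ((a * b, 0) : dual A).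
  move=> Ja Jb; have [[a' a2] La /= ea] : [set x.1 | x in L] a by rewrite LE.
  have [[b' b2] Lb /= eb] : [set x.1 | x in L] b by rewrite LE.
  subst a' b'.
  (* The product of the two lifts is [a b + (a b2 + a2 b) eps], whose eps part can be removed
     because it comes from the fibre. *)
  have -> : ((a * b, 0) : dual A) =
      ((a, a2) : dual A) * (b, b2) + (-1 : dual A) * (0, a * b2 + a2 * b).
    by congr (_, _) => /=; ring.
  apply: (LD); first exact: LM.
  apply: (LM); apply/flat; rewrite -LE.
  exists (((a, a2) : dual A) * (b2, 0) + ((b, b2) : dual A) * (a2, 0)).
    by apply: (LD); rewrite mulrC; exact: LM.
  by rewrite /= mulrC [b * a2]mulrC mulrC.
case: x => g g' e; have [/= g0 g'0] : f g = 0 /\ f g' = 0.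
  by move: e; rewrite /F dual_rmorphE /dual_map /= => -[].
have [a1 [b1 [a2 [b2 [[Ja1 Jb1] [Ja2 Jb2] gE]]]]] := ker_square g0.
have -> : ((g, g') : dual A) = ((g, 0) : dual A) + (0, g').
  by congr (_, _); rewrite /= ?addr0 ?add0r.
apply: (LD); last first.
  apply/flat => /=; rewrite g'0 -(rmorph0 f).
  suff : [set x.1 | x in L] 0 by rewrite LE.
  by exists 0.
have -> : ((g, 0) : dual A) = ((a1 * b1, 0) : dual A) + (a2 * b2, 0).
  by rewrite gE; congr (_, _); rewrite /= addr0.
by apply: (LD); exact: sq.
Qed.

Lemma hilb_tangent_iso_of_square :
  hilb_tangent_isomorphism iota kappa f d J.
Proof.
have scalE s (e : 'I_d -> dual A) (c : {ffun 'I_d -> dual K}) :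
    F (s - \sum_i dual_map iota (c i) * e i) =
    F s - \sum_i dual_map kappa (c i) * F (e i).
  rewrite rmorphB rmorph_sum; congr (_ - _); apply: eq_bigr => i _.
  rewrite rmorphM; congr (_ * _); congr (_, _); exact: fiota.
split; first split.
- move=> L [[L0 LD LM] [e he] LE]; split.
  + split.
    * by rewrite /= -[dual_map f 0]/(F 0) rmorph0.
    * by move=> x y /= Lx Ly; rewrite -[dual_map f _]/(F (x + y)) rmorphD; exact: LD.
    * by move=> x y /= Ly; rewrite -[dual_map f _]/(F (x * y)) rmorphM; exact: LM.
  + have ex i : exists e', F e' = e i := dual_map_onto (e i).
    have [e' e'E] := choice ex; exists e' => s; have [c [cL cu]] := he (F s).
    have eE (c' : {ffun 'I_d -> dual K}) :
        dual_map f (s - \sum_i dual_map iota (c' i) * e' i) =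
        F s - \sum_i dual_map kappa (c' i) * e i.
      by rewrite -[dual_map f _]/(F _) scalE; under eq_bigr do rewrite e'E.
    exists c; split; first by rewrite /= eE.
    by move=> c' /=; rewrite eE; exact: cu.
  + apply/seteqP; split=> [_ [x Lx <-]|g].
      by rewrite /= -LE; exists (F x).
    rewrite /= -LE => -[[x1 x2] Lx /= x1E]; have [b bE] := ontof x2.
    by exists ((g, b) : dual A) => //=; rewrite /dual_map /= bE -x1E.
- move=> L L' _ _ e; apply/seteqP; split=> x; have [w <-] := dual_map_onto x.
    by move=> Lw; have : (dual_map f @^-1` L) w by []; rewrite e.
  by move=> Lw; have : (dual_map f @^-1` L') w by []; rewrite -e.
- move=> L tL; have ker := dual_kernel_sub tL; have [[L0 LD LM] [e he] LE] := tL.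
  (* Since [L] contains the kernel of [F], it is the preimage of its image, which is the deformation
     sought on [B]. *)
  have inL x y : L y -> F x = F y -> L x.
    move=> Ly e'; rewrite -(subrK y x); apply: (LD) => //; apply: ker.
    by rewrite rmorphB e' subrr.
  have preE x : [set F y | y in L] (F x) <-> L x.
    by split=> [[y Ly e']|Lx]; [exact: inL Ly _|exists x].
  exists [set F y | y in L]; last by apply/seteqP; split=> x Lx; apply/preE.
  split.
  + split.
    * by exists 0 => //; rewrite rmorph0.
    * by move=> _ _ [x Lx <-] [y Ly <-]; exists (x + y); [exact: LD|rewrite rmorphD].
    * move=> a _ [x Lx <-]; have [b <-] := dual_map_onto a.
      by exists (b * x); [exact: LM|rewrite rmorphM].
  + exists (fun i => F (e i)) => s; have [s' <-] := dual_map_onto s.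
    have [c [cL cu]] := he s'; exists c; split; first by rewrite -scalE; exact/preE.
    by move=> c'; rewrite -scalE => /preE; exact: cu.
  + apply/seteqP; split=> [_ [_ [x Lx <-] <-]|g].
      by have : [set x.1 | x in L] x.1 by [exists x]; rewrite LE.
    have [g' <-] := ontof g; rewrite -[J (f g')]/((f @^-1` J) g') -LE.
    by move=> [x Lx <-]; exists (F x) => //; exists x.
- move=> L L' _ _; apply/seteqP; split=> x /=.
    move=> [b [b' [Lb L'b' bb']]]; have [a aE] := ontof b.
    exists a, (x.2 - a); split; rewrite /= /dual_map /= ?aE //.
      by rewrite rmorphB [f x.2]bb' aE addrC addKr.
    by rewrite addrC subrK.
  move=> [b [b' [Lb L'b' bb']]]; exists (f b), (f b'); split=> //.
  by rewrite /= bb' rmorphD.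
- move=> s L _; apply/seteqP; split=> x /=.
    move=> [b [y [Lb Jy e]]]; have [a aE] := ontof b.
    exists a, (x.2 - iota s * a); split; rewrite /= /dual_map /= ?aE //.
      by rewrite rmorphB rmorphM fiota aE [f x.2]e addrC addKr.
    by rewrite addrC subrK.
  move=> [b [y [Lb Jy e]]]; exists (f b), (f y); split=> //.
  by rewrite /= e rmorphD rmorphM fiota.
Qed.

End HilbertTangent.

(** * Extensions of modules supported at a point *)

Definition linear_of (A : pzRingType) (M N : lmodType A) (f : M -> N)
    (lf : linear f) : {linear M -> N} :=
  HB.pack f (GRing.isLinear.Build A M N *:%R f lf).

Lemma inj_onto_bijective (A B : Type) (f : A -> B) :
  injective f -> onto f -> bijective f.
Proof.
move=> fi fs; have [g fg] := choice fs.
by exists g => // x; apply: fi.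
Qed.

Section Modules.
Variables (K : fieldType) (X : kspace K).
Implicit Types (M N : omod X) (U V W : opens X).

Lemma mres_id M U (h : U `<=` U) m : mres M h m = m.
Proof. by have [[mid _] _] := @msec_sheaf _ _ M; exact: mid. Qed.

Lemma mres_comp M U V W (hVU : V `<=` U) (hWV : W `<=` V) (hWU : W `<=` U) m :
  mres M hWV (mres M hVU m) = mres M hWU m.
Proof. by have [[_ mc] _] := @msec_sheaf _ _ M; exact: mc. Qed.

Lemma mres_cancel M U V (h : V `<=` U) (h' : U `<=` V) :
  cancel (mres M h) (mres M h').
Proof. by move=> s; rewrite (mres_comp _ _ (@subset_refl _ U)) mres_id. Qed.

Lemma mres0 M U V (h : V `<=` U) : mres M h 0 = 0.
Proof.
apply: (addrI (mres M h 0)).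
by rewrite -mresD !addr0.
Qed.

Lemma msec_local M U (m n : M U) :
  (forall x, U x -> exists V (h : V `<=` U), V x /\ mres M h m = mres M h n) ->
  m = n.
Proof.
move=> H; have [[rid rc] glue] := @msec_sheaf _ _ M.
pose I := {V : opens X | exists h : V `<=` U, mres M h m = mres M h n}.
pose W (i : I) := sval i.
have hW (i : I) : W i `<=` U by have [h _] := svalP i.
have eW (i : I) : mres M (hW i) m = mres M (hW i) n.
  by have [h e] := svalP i; rewrite (Prop_irrelevance (hW i) h).
have cov : U `<=` \bigcup_i W i.
  move=> x /H[V [h [Vx e]]].
  by exists (exist _ V (ex_intro _ h e)).
have [|t [_ tu]] := glue I W U hW cov (fun i => mres M (hW i) m).
  move=> i j V hi hj.
  by rewrite !(mres_comp _ _ (subset_trans hi (hW i))).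
by rewrite -(tu m) // -(tu n).
Qed.

(* On sections, hence a skyscraper at p when p is closed. *)
Definition supported_at (p : X) M : Prop :=
  forall V, ~ V p -> forall m m' : M V, m = m'.

Section Supported.
Variables (p : X) (M : omod X).
Hypotheses (clp : closed [set p]) (supM : supported_at p M).

Let open_compl : open (~` [set p]). Proof. by rewrite openC. Qed.

(** [U] is covered by [V] and the complement of [p], over which [M] is zero; the same cover, with
    the section 0 off [p], gives surjectivity. *)
Lemma supported_res_inj U V (h : V `<=` U) : V p -> injective (mres M h).
Proof.
move=> Vp m n e; apply: msec_local => x Ux; have [xp|xp] := pselect (x = p).
  by exists V, h; split=> //; rewrite xp.
exists (opensI U (Opens open_compl)), (@opensIl _ _ _); split; first by split.
by apply: supM => -[_]; apply.
Qed.

Lemma supported_res_onto U V (h : V `<=` U) : V p -> onto (mres M h).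
Proof.
move=> Vp n; have [_ glue] := @msec_sheaf _ _ M.
pose W (b : bool) := if b then V else opensI U (Opens open_compl).
have hW b : W b `<=` U by case: b => //; exact: opensIl.
have cov : U `<=` \bigcup_b W b.
  move=> x Ux; have [xp|xp] := pselect (x = p).
    by exists true => //=; rewrite xp.
  by exists false.
pose s b : M (W b) := if b return M (W b) then n else 0.
have [i j O hi hj|t [tE _]] := glue bool W U hW cov s.
  have [Op|Op] := pselect (O p); last exact: supM.
  case: i hi => hi; last by case: (hi _ Op) => _ /(_ erefl).
  case: j hj => hj; last by case: (hj _ Op) => _ /(_ erefl).
  by rewrite (Prop_irrelevance hi hj).
by exists t; have := tE true; rewrite /= (Prop_irrelevance (hW true) h).
Qed.

End Supported.

Lemma supported_extension (p : X) M N (E : extension M N) :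
  supported_at p M -> supported_at p N -> supported_at p E.
Proof.
move=> sM sN V Vp m m'; suff z (e : E V) : e = 0 by rewrite (z m) (z m').
have [n <-] : exists n, ext_in E V n = e.
  by apply/ext_exact; exact: sM.
by rewrite (sN V Vp n 0) linear0.
Qed.

(** Surjectivity is only local in an extension; a preimage near [p] extends to [V] because the
    middle term is also supported at [p]. *)
Lemma extension_onto (p : X) M N (E : extension M N) : closed [set p] ->
  supported_at p M -> supported_at p N -> forall V, onto (ext_out E V).
Proof.
move=> clp sM sN V m; have [Vp|Vp] := pselect (V p); last first.
  by exists 0; exact: sM.
have [W [h [Wp [e eE]]]] := ext_surj E m Vp.
have [e' e'E] := supported_res_onto clp (supported_extension sM sN) h Wp e.
exists e'; apply: (supported_res_inj clp sM (h := h) Wp).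
by rewrite -hfun_res e'E.
Qed.

End Modules.

Section RestrictModule.
Variables (K : fieldType) (Y : kspace K) (U : opens Y) (E : omod Y).

Definition restrict_sec (V : opens (open_sub U)) : lmodType (sec (open_sub U) V) :=
  E (open_image V).

Definition restrict_res (V W : opens (open_sub U)) (h : W `<=` V) :
    restrict_sec V -> restrict_sec W :=
  mres E (open_image_sub h).

Lemma restrict_sheaf : is_sheaf restrict_res.
Proof.
have [[rid rcomp] glue] := @msec_sheaf _ _ E.
split; first split.
- by move=> V h s; exact: rid.
- by move=> V V' W h1 h2 h3 s; exact: rcomp.
move=> J W V hW cV s hs.
apply: (glue J (fun j => open_image (W j)) (open_image V)
  (fun j => open_image_sub (hW j))).
  by move=> _ [x /cV[j _ Wjx] <-]; exists j => //; exists x.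
move=> i j O hi hj.
pose O' := opensI (W i) (W j).
have h3 : O `<=` open_image O'.
  move=> x Ox; have [y Wy yx] := hi _ Ox; exists y => //; split=> //.
  by apply/open_imageP; rewrite yx; exact: hj.
have := congr1 (mres E h3) (hs i j O' (@opensIl _ _ _) (@opensIr _ _ _)).
by rewrite /restrict_res (rcomp _ _ _ _ _ hi) (rcomp _ _ _ _ _ hj).
Qed.

Definition restrict_omod : omod (open_sub U).
Proof.
apply: (@OMod K (open_sub U) restrict_sec restrict_res).
- by move=> V W h m n; exact: mresD.
- by move=> V W h a m; exact: mresZ.
- exact: restrict_sheaf.
Defined.

End RestrictModule.

Section Ext.
Variables (K : fieldType) (Y S : kspace K) (U : opens Y).
Variables (k : morph (open_sub U) S) (M : omod (open_sub U)) (P : open_sub U).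
Hypotheses (clY : closed [set set_val P]) (clS : closed [set k P]).
Hypotheses (clU : closed [set P]) (supM : supported_at P M).
Hypothesis injk : injective k.
Hypothesis lift : forall (W : opens (open_sub U)) (V : opens S) (s : sec _ W),
  W P -> V (k P) -> exists (V' : opens S) (h : inverse_image k V' `<=` W),
    [/\ V' (k P), V' `<=` V & exists a, comorph k V' a = restr h s].

(** The inclusion of [I] in [J^2] near [k P], with membership in [J] read as annihilating [M]. *)
Hypothesis square : forall (V : opens S) (a : sec S V),
  V (k P) -> comorph k V a = 0 -> exists (V' : opens S) (h : V' `<=` V) f1 f2,
    [/\ V' (k P), restr h a = f1 * f2,
        forall m : M (inverse_image k V'), comorph k V' f1 *: m = 0 &
        forall m : M (inverse_image k V'), comorph k V' f2 *: m = 0].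

Let MY := pushforward (open_incl U) M.
Let MS := pushforward k M.
Let over (V : opens S) : opens Y := open_image (inverse_image k V).

Lemma supported_pushY : supported_at (set_val P) MY.
Proof. by move=> V VP; exact: supM. Qed.

Lemma supported_pushS : supported_at (k P) MS.
Proof. by move=> V VP; exact: supM. Qed.

Lemma overP (V : opens S) : over V (set_val P) <-> V (k P).
Proof. exact: open_imageP. Qed.

Lemma over_mono (V W : opens S) : W `<=` V -> over W `<=` over V.
Proof. by move=> h _ [x Vx <-]; exists x => //; exact: h. Qed.

(** With [from_over], identifies two opens of [U] that have the same points but are different
    terms. *)
Lemma to_over (V : opens S) :
  inverse_image k V `<=` inverse_image (open_incl U) (over V).
Proof. by move=> x Vx; apply/open_imageP. Qed.

Lemma from_over (V : opens S) :
  inverse_image (open_incl U) (over V) `<=` inverse_image k V.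
Proof. by move=> x /open_imageP. Qed.

Lemma from_over_scalar (V : opens S) (a : sec S V) :
  comorph (open_incl U) (over V) (comorph k V a) =
  restr (@from_over V) (comorph k V a).
Proof.
set G : sec Y (over V) := comorph k V a.
change (restr (incl_image (V := over V)) G = restr (open_image_sub (@from_over V)) G).
exact: (congr1 (fun h => restr h G) (Prop_irrelevance _ _)).
Qed.

(** * The extension on [S] induced by an extension on [Y] *)

Section Restrict.
Variable E : extension MY MY.

Let F := pushforward k (restrict_omod U E).

Definition restrict_in (V : opens S) : {linear MS V -> F V}.
Proof.
apply: (@linear_of _ (MS V) (F V)
  (fun t => ext_in E (over V) (mres M (@from_over V) t : MY (over V)))).
move=> a t t'.
have -> : mres M (@from_over V) (a *: t + t') =
    (comorph k V a : sec Y (over V)) *: (mres M (@from_over V) t : MY (over V))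
    + (mres M (@from_over V) t' : MY (over V)).
  rewrite mresD; congr (_ + _).
  have -> : (comorph k V a : sec Y (over V)) *: (mres M (@from_over V) t : MY (over V)) =
    comorph (open_incl U) (over V) (comorph k V a) *: (mres M (@from_over V) t).
    by [].
  by rewrite from_over_scalar -mresZ.
by rewrite linearP.
Defined.

Definition restrict_out (V : opens S) : {linear F V -> MS V}.
Proof.
apply: (@linear_of _ (F V) (MS V)
  (fun e => mres M (@to_over V) (ext_out E (over V) e))).
move=> a e e'.
have -> : ext_out E (over V) (a *: e + e') =
    (comorph k V a : sec Y (over V)) *: ext_out E (over V) e + ext_out E (over V) e'.
  by rewrite -linearP.
rewrite mresD; congr (_ + _).
transitivity (mres M (@to_over V)
    (comorph (open_incl U) (over V) (comorph k V a) *: (ext_out E (over V) e : M _))).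
  by [].
rewrite mresZ from_over_scalar.
by rewrite (restr_cancel (@from_over V) (@to_over V)).
Defined.

Lemma restrict_in_res (V W : opens S) (h : W `<=` V) m :
  restrict_in W (mres MS h m) = mres F h (restrict_in V m).
Proof.
have hE : over W `<=` over V by exact: over_mono.
transitivity (mres E hE (ext_in E (over V) (mres M (@from_over V) m : MY (over V)))).
  rewrite -hfun_res; congr (ext_in E (over W) _).
  have hs := subset_trans (@from_over W) (inverse_image_mono (f := k) h).
  by rewrite /= /push_res (mres_comp _ _ hs) (mres_comp _ _ hs).
exact: (congr1 (fun h => mres E h _) (Prop_irrelevance _ _)).
Qed.

Lemma restrict_out_res (V W : opens S) (h : W `<=` V) m :
  restrict_out W (mres F h m) = mres MS h (restrict_out V m).
Proof.
have hE : over W `<=` over V by exact: over_mono.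
transitivity (mres M (@to_over W) (mres MY hE (ext_out E (over V) m))).
  rewrite -hfun_res.
  by rewrite (Prop_irrelevance hE (open_image_sub (inverse_image_sub (f := k) h))).
have hs : inverse_image k W `<=` inverse_image (open_incl U) (over V).
  exact: subset_trans (@to_over W) (inverse_image_mono (f := open_incl U) hE).
by rewrite /= /push_res (mres_comp _ _ hs) (mres_comp _ _ hs).
Qed.

Lemma restrict_in_inj (V : opens S) : injective (restrict_in V).
Proof.
move=> m n /(@ext_inj _ _ _ _ E (over V)).
by move=> /(congr1 (mres M (@to_over V))); rewrite !mres_cancel.
Qed.

Lemma restrict_exact (V : opens S) e :
  restrict_out V e = 0 <-> exists n, restrict_in V n = e.
Proof.
split=> [e0|[n <-]].
  have : ext_out E (over V) e = 0.
    have := congr1 (mres M (@from_over V)) e0.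
    by rewrite /= mres_cancel mres0.
  move=> /ext_exact[n <-]; exists (mres M (@to_over V) n).
  by rewrite /= mres_cancel.
have -> : restrict_out V (restrict_in V n) =
  mres M (@to_over V)
    (ext_out E (over V) (ext_in E (over V) (mres M (@from_over V) n))).
  by [].
by rewrite (ext_exact (ext_in E (over V) _)).2 ?mres0 //; exists (mres M (@from_over V) n).
Qed.

(** Local surjectivity over [Y] yields opens of [Y], not of [S]; support at a closed point allows
    [W = V]. *)
Lemma restrict_surj (V : opens S) (m : MS V) x : V x ->
  exists (W : opens S) (h : W `<=` V),
    W x /\ exists e, restrict_out W e = mres MS h m.
Proof.
move=> Vx; exists V, (@subset_refl _ V); split=> //; rewrite mres_id.
have [e eE] := extension_onto E clY supported_pushY supported_pushY
  (mres M (@from_over V) m : MY (over V)).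
by exists e; rewrite /= eE mres_cancel.
Qed.

Definition restrict_extension : extension MS MS :=
  @Extension _ _ MS MS F (OModHom restrict_in_res) (OModHom restrict_out_res)
    restrict_in_inj restrict_exact restrict_surj.

Lemma restrict_canonical : ext1_canonical E restrict_extension.
Proof.
exists (fun V e => e); split=> //.
- by move=> V; exists id.
- move=> V W h h' e.
  exact: (congr1 (fun h => mres E h _) (Prop_irrelevance _ _)).
- move=> V h t; rewrite (Prop_irrelevance h (@to_over V)).
  by congr (ext_in E _ _); rewrite mres_cancel.
- by move=> V h e; rewrite (Prop_irrelevance h (@to_over V)).
Qed.

End Restrict.

(** * The extension on [Y] induced by an extension on [S] *)

Section Extend.
Variable F : extension MS MS.

Let supF : supported_at (k P) F.
Proof. exact: supported_extension supported_pushS supported_pushS. Qed.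

Lemma kernel_kills (V : opens S) (a : sec S V) (m : F V) :
  V (k P) -> comorph k V a = 0 -> a *: m = 0.
Proof.
move=> VP a0; have [V' [h [f1 [f2 [V'P aE f10 f20]]]]] := square VP a0.
apply: (supported_res_inj clS supF (h := h) V'P).
rewrite mresZ mres0 aE -scalerA.
have : ext_out F V' (f2 *: mres F h m) = 0 by rewrite linearZ; exact: f20.
move=> /ext_exact[n <-]; rewrite -linearZ.
by rewrite [f1 *: n]f10 linear0.
Qed.

(** The implication encodes all of [S] or the complement of [k P], with no case distinction in the
    set itself. *)
Lemma ptopen_open (W : opens Y) : open [set x | x = k P -> W (set_val P)].
Proof.
have [WP|WP] := pselect (W (set_val P)).
  suff -> : [set x | x = k P -> W (set_val P)] = setT by exact: openT.
  by apply/seteqP; split=> x //= _ _.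
suff -> : [set x | x = k P -> W (set_val P)] = ~` [set k P] by rewrite openC.
by apply/seteqP; split=> x /= h /h.
Qed.

(* An extension F on S is supported at k P, so its sections over [ptopen W] are
   its stalk if W contains P and 0 otherwise: over W they are the sections of
   the corresponding module on Y.                                            *)
Definition ptopen (W : opens Y) : opens S := Opens (ptopen_open W).

Lemma ptopenP (W : opens Y) : ptopen W (k P) <-> W (set_val P).
Proof. by split=> [|WP _]; [apply|]. Qed.

Lemma ptopen_mono (V W : opens Y) : W `<=` V -> ptopen W `<=` ptopen V.
Proof. by move=> h x Wx xP; apply: h; exact: Wx. Qed.

Lemma sub_ptopen (W : opens Y) (V : opens S) : W (set_val P) -> V `<=` ptopen W.
Proof. by move=> WP x _ _. Qed.

Lemma ptopen_pull (W : opens Y) :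
  inverse_image (open_incl U) W `<=` inverse_image k (ptopen W).
Proof. by move=> x Wx /injk <-. Qed.

Lemma lift_at (W : opens Y) (a : sec Y W) (V0 : opens S) :
  W (set_val P) -> V0 (k P) ->
  exists (V : opens S) (hW : over V `<=` W) (al : sec S V),
    [/\ V (k P), V `<=` V0 & comorph k V al = restr hW a].
Proof.
move=> WP V0P; have WP' : inverse_image (open_incl U) W P by [].
have [V [h [VP VV0 [al alE]]]] := lift (comorph (open_incl U) W a) WP' V0P.
have hW : over V `<=` W by move=> _ [x /h Wx <-].
exists V, hW, al; split=> //; rewrite alE.
change (restr (open_image_sub h) (restr (incl_image (V := W)) a) = restr hW a).
exact: (@restr_comp _ Y).
Qed.

Lemma lift_at2 (W : opens Y) (a b : sec Y W) :
  W (set_val P) ->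
  exists (V : opens S) (h : V `<=` ptopen W) (hW : over V `<=` W)
    (al be : sec S V),
    [/\ V (k P), comorph k V al = restr hW a & comorph k V be = restr hW b].
Proof.
move=> WP; have [V1 [h1 [al [V1P _ alE]]]] := lift_at a WP ((ptopenP W).2 WP).
have [V [hW [be [VP VV1 beE]]]] := lift_at b WP V1P.
exists V, (@sub_ptopen W V WP), hW, (restr VV1 al), be; split=> //.
rewrite (comorph_restr VV1 (inverse_image_mono VV1)) alE.
change (restr (open_image_sub (inverse_image_mono (f := k) VV1)) (restr h1 a) =
  restr hW a).
exact: (@restr_comp _ Y).
Qed.

(** A separate name, to carry a module structure over the sections of [Y]. *)
Definition extend_carrier (W : opens Y) : Type := F (ptopen W).

HB.instance Definition _ (W : opens Y) := GRing.Zmodule.on (extend_carrier W).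

(* Sections of O_Y lift to O_S only near k P; the action is independent of the
   lifts by [kernel_kills].                                                  *)
Definition acts (W : opens Y) (a : sec Y W) (m m' : F (ptopen W)) : Prop :=
  forall (V : opens S) (h : V `<=` ptopen W) (hW : over V `<=` W) (al : sec S V),
    V (k P) -> comorph k V al = restr hW a ->
    mres F h m' = al *: mres F h m.

Lemma acts_exists (W : opens Y) (a : sec Y W) (m : F (ptopen W)) :
  exists m', acts a m m'.
Proof.
have [WP|WP] := pselect (W (set_val P)); last first.
  (* If [W] misses [P], the condition is vacuous: no [V] through [k P] has [over V] inside [W]. *)
  by exists m => V h hW al VP; case: WP; apply: hW; apply/overP.
have [V0 [h0 [hW0 [al0 [_ [V0P al0E _]]]]]] := lift_at2 a a WP.
have [m' m'E] := supported_res_onto clS supF h0 V0P (al0 *: mres F h0 m).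
exists m' => V h hW al VP alE.
have hl := @opensIl _ V V0; have hr := @opensIr _ V V0.
apply: (supported_res_inj clS supF (h := hl)) => //.
have hI := subset_trans hl h.
rewrite mresZ !(mres_comp _ _ hI) -(mres_comp h0 hr hI) m'E mresZ (mres_comp _ _ hI).
(* The two lifts of [a] have the same pullback on the overlap, so their difference acts by zero. *)
apply/eqP; rewrite -subr_eq0 -scalerBl; apply/eqP; apply: kernel_kills => //.
rewrite rmorphB (comorph_restr hr (inverse_image_mono hr)) al0E.
rewrite (comorph_restr hl (inverse_image_mono hl)) alE.
apply/eqP; rewrite subr_eq0; apply/eqP.
change (restr (open_image_sub (inverse_image_mono (f := k) hr)) (restr hW0 a) =
  restr (open_image_sub (inverse_image_mono (f := k) hl)) (restr hW a)).
have hIW : over (opensI V V0) `<=` W := subset_trans (over_mono hl) hW.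
by rewrite !(restr_comp _ _ hIW).
Qed.

Definition act (W : opens Y) (a : sec Y W) (m : extend_carrier W) :
    extend_carrier W :=
  sval (cid (acts_exists a m)).

Lemma actP (W : opens Y) (a : sec Y W) (m : F (ptopen W)) : acts a m (act a m).
Proof. exact: svalP (cid (acts_exists a m)). Qed.

Lemma actE (W : opens Y) (a : sec Y W) (m : F (ptopen W)) (V : opens S)
    (h : V `<=` ptopen W) (hW : over V `<=` W) (al : sec S V) :
  V (k P) -> comorph k V al = restr hW a ->
  mres F h (act a m) = al *: mres F h m.
Proof. by move=> VP; exact: actP. Qed.

(** Reduces an identity involving the action of [a] and [b] to an open of [S] on which both lift,
    where it becomes an identity in [F]. *)
Lemma extend_eq (W : opens Y) (a b : sec Y W) (m m' : F (ptopen W)) :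
  (forall (V : opens S) (h : V `<=` ptopen W) (hW : over V `<=` W)
      (al be : sec S V),
    V (k P) -> comorph k V al = restr hW a -> comorph k V be = restr hW b ->
    mres F h m = mres F h m') -> m = m'.
Proof.
move=> H; have [WP|WP] := pselect (W (set_val P)); last first.
  by apply: supF => /ptopenP.
have [V [h [hW [al [be [VP alE beE]]]]]] := lift_at2 a b WP.
by apply: (supported_res_inj clS supF (h := h) VP); exact: H alE beE.
Qed.

Fact act_scaleA (W : opens Y) (a b : sec Y W) v : act a (act b v) = act (a * b) v.
Proof.
apply: (extend_eq (a := a) (b := b)) => V h hW al be VP alE beE.
rewrite (actE _ _ VP alE) (actE _ _ VP beE) scalerA; apply/esym; apply: (actE _ _ (hW := hW)) => //.
by rewrite !rmorphM alE beE.
Qed.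

Fact act_scale1 (W : opens Y) : left_id 1 (@act W).
Proof.
move=> v; apply: (extend_eq (a := 1) (b := 1)) => V h hW al be VP alE beE.
by rewrite (actE v h (hW := hW) (al := 1)) ?scale1r // !rmorph1.
Qed.

Fact act_scaleDr (W : opens Y) : right_distributive (@act W) +%R.
Proof.
move=> a u v; apply: (extend_eq (a := a) (b := a)) => V h hW al be VP alE beE.
by rewrite mresD !(actE _ _ VP alE) mresD scalerDr.
Qed.

Fact act_scaleDl (W : opens Y) v : {morph (@act W)^~ v : a b / a + b}.
Proof.
move=> a b; apply: (extend_eq (a := a) (b := b)) => V h hW al be VP alE beE.
rewrite mresD (actE _ _ VP alE) (actE _ _ VP beE) -scalerDl; apply: (actE _ _ (hW := hW)) => //.
by rewrite !rmorphD alE beE.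
Qed.

HB.instance Definition _ (W : opens Y) :=
  GRing.Zmodule_isLmodule.Build (sec Y W) (extend_carrier W)
    (@act_scaleA W) (@act_scale1 W) (@act_scaleDr W) (@act_scaleDl W).

Definition extend_sec (W : opens Y) : lmodType (sec Y W) := extend_carrier W.

Definition extend_res (V W : opens Y) (h : W `<=` V) (m : extend_sec V) :
    extend_sec W :=
  mres F (ptopen_mono h) m.

(** Members of the cover through [P] all carry the stalk of [F], so the section over one of them,
    [W i0], determines the glued section; the other members carry zero. *)
Lemma extend_sheaf : is_sheaf extend_res.
Proof.
have presheaf : is_presheaf extend_res.
  split=> [V h s|V V' W h1 h2 h3 s]; first exact: mres_id.
  exact: mres_comp.
split=> // J W V hW cV s hs.
have [VP|VP] := pselect (V (set_val P)); last first.
  have z (W' : opens Y) (hW' : W' `<=` V) (t t' : extend_sec W') : t = t'.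
    by apply: supF => /ptopenP /hW'.
  exists 0; split=> [i|t _]; exact: z.
have [i0 _ WP0] := cV _ VP.
have WP0' : ptopen (W i0) (k P) by apply/ptopenP.
have [t tE] := supported_res_onto clS supF (ptopen_mono (hW i0)) WP0' (s i0).
exists t; split=> [i|t' /(_ i0) t'E]; last first.
  by apply: (supported_res_inj clS supF (h := ptopen_mono (hW i0)) WP0'); rewrite tE.
have [WP|WP] := pselect (W i (set_val P)); last first.
  by apply: supF => /ptopenP.
have IP : ptopen (opensI (W i) (W i0)) (k P) by apply/ptopenP.
have hl := @opensIl _ (W i) (W i0); have hr := @opensIr _ (W i) (W i0).
apply: (supported_res_inj clS supF (h := ptopen_mono hl) IP).
rewrite -[RHS]/(extend_res hl (s i)) (hs i i0 _ hl hr) /extend_res -tE.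
have hI := ptopen_mono (subset_trans hl (hW i)).
by rewrite !(mres_comp _ _ hI).
Qed.

Lemma extend_resZ (V W : opens Y) (h : W `<=` V) a (m : extend_sec V) :
  extend_res h (a *: m) = restr h a *: extend_res h m.
Proof.
apply: (extend_eq (a := restr h a) (b := restr h a)).
move=> V' hV' hW al be VP alE beE.
have alE' : comorph k V' al = restr (subset_trans hW h) a.
  by rewrite alE; exact: (@restr_comp _ Y).
have hs := subset_trans hV' (ptopen_mono h).
rewrite (actE _ _ VP alE) /extend_res !(mres_comp _ _ hs).
exact: (actE _ _ VP alE').
Qed.

Definition extend_omod : omod Y.
Proof.
apply: (@OMod K Y extend_sec extend_res).
- by move=> V W h m n; exact: mresD.
- exact: extend_resZ.
- exact: extend_sheaf.
Defined.

Lemma pull_inj (W : opens Y) : injective (mres M (@ptopen_pull W)).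
Proof.
have [WP|WP] := pselect (W (set_val P)).
  exact: (supported_res_inj clU supM).
by move=> m n _; apply: supM => /ptopenP.
Qed.

Lemma pull_onto (W : opens Y) : onto (mres M (@ptopen_pull W)).
Proof.
have [WP|WP] := pselect (W (set_val P)).
  exact: (supported_res_onto clU supM).
by move=> n; exists 0; exact: supM.
Qed.

(** Inverse of a restriction that is bijective because its two opens both contain [P] or both miss
    it. *)
Definition unpull (W : opens Y) (m : M (inverse_image (open_incl U) W)) :
    M (inverse_image k (ptopen W)) :=
  sval (cid (pull_onto m)).

Lemma unpullE (W : opens Y) (m : M (inverse_image (open_incl U) W)) :
  mres M (@ptopen_pull W) (unpull m) = m.
Proof. exact: svalP (cid (pull_onto m)). Qed.

Lemma unpull_res (W : opens Y) m (V : opens (open_sub U))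
    (h : V `<=` inverse_image k (ptopen W)) (h' : V `<=` inverse_image (open_incl U) W) :
  mres M h (unpull m) = mres M h' m.
Proof. by rewrite -[in RHS](unpullE m) (mres_comp _ _ h). Qed.

Lemma pull_scalar (W : opens Y) (a : sec Y W) (V : opens S) (hW : over V `<=` W)
    (al : sec S V) (h' : inverse_image k V `<=` inverse_image (open_incl U) W) :
  comorph k V al = restr hW a ->
  restr h' (comorph (open_incl U) W a) = comorph k V al.
Proof.
move=> ->.
change (restr (open_image_sub h') (restr (incl_image (V := W)) a) = restr hW a).
exact: (@restr_comp _ Y).
Qed.

Lemma pull_sub (W : opens Y) (V : opens S) (hW : over V `<=` W) :
  inverse_image k V `<=` inverse_image (open_incl U) W.
Proof. by move=> x Vx; apply: hW; exists x. Qed.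

Definition extend_in (W : opens Y) : {linear MY W -> extend_omod W}.
Proof.
apply: (@linear_of _ (MY W) (extend_omod W) (fun n => ext_in F (ptopen W) (unpull n))).
move=> a n n'.
apply: (extend_eq (a := a) (b := a)) => V h hW al be VP alE beE.
have hk : inverse_image k V `<=` inverse_image k (ptopen W) by exact: inverse_image_mono.
have inE t : mres F h (ext_in F (ptopen W) (unpull t)) =
    ext_in F V (mres M (pull_sub hW) t : MS V).
  rewrite -hfun_res; congr (ext_in F V _).
  by rewrite -(unpull_res t hk (pull_sub hW)); exact:
    (congr1 (fun h => mres M h _) (Prop_irrelevance _ _)).
rewrite mresD (actE _ _ VP alE) !inE -linearP; congr (ext_in F V _).
rewrite mresD; congr (_ + _).
transitivity (mres M (pull_sub hW) (comorph (open_incl U) W a *: (n : M _))); first by [].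
by rewrite mresZ (pull_scalar (pull_sub hW) alE).
Defined.

Definition extend_out (W : opens Y) : {linear extend_omod W -> MY W}.
Proof.
apply: (@linear_of _ (extend_omod W) (MY W)
  (fun e => mres M (@ptopen_pull W) (ext_out F (ptopen W) e))).
move=> a e e'; have [WP|WP] := pselect (W (set_val P)); last exact: supM.
have [V [h [hW [al [_ [VP alE _]]]]]] := lift_at2 a a WP.
apply: (supported_res_inj clU supM (h := pull_sub hW)) => //.
have hk : inverse_image k V `<=` inverse_image k (ptopen W) by exact: inverse_image_mono.
have outE t :
    mres M (pull_sub hW) (mres M (@ptopen_pull W) (ext_out F (ptopen W) t)) =
    ext_out F V (mres F h t) :> MS V.
  rewrite (mres_comp _ _ hk) hfun_res.
  exact: (congr1 (fun h => mres M h _) (Prop_irrelevance _ _)).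
rewrite outE mresD (actE _ _ VP alE) linearP mresD.
congr (_ + _); last exact/esym/outE.
transitivity (mres M (pull_sub hW) (comorph (open_incl U) W a *:
  (mres M (@ptopen_pull W) (ext_out F (ptopen W) e)))); last by [].
by rewrite mresZ (pull_scalar (pull_sub hW) alE) outE.
Defined.

Lemma extend_inE (W : opens Y) (n : MY W) :
  extend_in W n = ext_in F (ptopen W) (unpull n).
Proof. by []. Qed.

Lemma extend_outE (W : opens Y) (e : extend_omod W) :
  extend_out W e = mres M (@ptopen_pull W) (ext_out F (ptopen W) e).
Proof. by []. Qed.

Lemma extend_resE (V W : opens Y) (h : W `<=` V) (e : extend_omod V) :
  mres extend_omod h e = mres F (ptopen_mono h) e.
Proof. by []. Qed.

Lemma extend_in_res (V W : opens Y) (h : W `<=` V) m :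
  extend_in W (mres MY h m) = mres extend_omod h (extend_in V m).
Proof.
rewrite extend_resE !extend_inE -hfun_res; congr (ext_in F _ _).
apply: pull_inj.
have hs := subset_trans (@ptopen_pull W)
  (inverse_image_mono (f := k) (ptopen_mono h)).
rewrite unpullE /= /push_res (mres_comp _ _ hs).
by rewrite (unpull_res m _ (inverse_image_mono (f := open_incl U) h));
  exact: (congr1 (fun h => mres M h _) (Prop_irrelevance _ _)).
Qed.

Lemma extend_out_res (V W : opens Y) (h : W `<=` V) m :
  extend_out W (mres extend_omod h m) = mres MY h (extend_out V m).
Proof.
rewrite extend_resE !extend_outE hfun_res /= /push_res.
have hs := subset_trans (@ptopen_pull W)
  (inverse_image_mono (f := k) (ptopen_mono h)).
by rewrite !(mres_comp _ _ hs).
Qed.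

Lemma extend_in_inj (W : opens Y) : injective (extend_in W).
Proof.
move=> m n /(@ext_inj _ _ _ _ F (ptopen W)) e.
by rewrite -(unpullE m) e unpullE.
Qed.

Lemma extend_exact (W : opens Y) e :
  extend_out W e = 0 <-> exists n, extend_in W n = e.
Proof.
have pinj := @pull_inj W.
split=> [e0|[n <-]].
  have /ext_exact[n <-] : ext_out F (ptopen W) e = 0.
    by apply: pinj; rewrite mres0; exact: e0.
  exists (mres M (@ptopen_pull W) n); congr (ext_in F _ _).
  by apply: pinj; rewrite unpullE.
have -> : extend_out W (extend_in W n) =
  mres M (@ptopen_pull W) (ext_out F (ptopen W) (ext_in F (ptopen W) (unpull n))) by [].
by rewrite (ext_exact (ext_in F (ptopen W) _)).2 ?mres0 //; exists (unpull n).
Qed.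

Lemma extend_surj (W : opens Y) (m : MY W) x : W x ->
  exists (V : opens Y) (h : V `<=` W),
    V x /\ exists e, extend_out V e = mres MY h m.
Proof.
move=> Wx; exists W, (@subset_refl _ W); split=> //; rewrite mres_id.
have [e eE] := extension_onto F clS supported_pushS supported_pushS
  (unpull m : MS (ptopen W)).
by exists e; rewrite /= eE unpullE.
Qed.

Definition extend_extension : extension MY MY :=
  @Extension _ _ MY MY extend_omod (OModHom extend_in_res) (OModHom extend_out_res)
    extend_in_inj extend_exact extend_surj.

Lemma sub_ptopen_over (V : opens S) : V `<=` ptopen (over V).
Proof. by move=> x Vx xP; apply/overP; rewrite -xP. Qed.

(** The comparison map is the restriction from [ptopen (over V)] to [V], bijective by support at
    [k P]. *)
Lemma extend_canonical : ext1_canonical extend_extension F.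
Proof.
exists (fun V e => mres F (@sub_ptopen_over V) e); split.
- move=> V; have [VP|VP] := pselect (V (k P)).
    apply: inj_onto_bijective.
      exact: (supported_res_inj clS supF).
    exact: (supported_res_onto clS supF).
  exists (fun=> 0) => e; last exact: supF.
  by apply: supF => /ptopenP/overP.
- move=> V a e e'; have [VP|VP] := pselect (V (k P)); last exact: supF.
  rewrite mresD; congr (_ + _).
  apply: (actE _ _ (hW := @subset_refl _ (over V))) => //.
  by rewrite [RHS](@restr_id _ Y).
- move=> V W h h' e; rewrite /= /extend_res.
  have hs := subset_trans h (@sub_ptopen_over V).
  by rewrite !(mres_comp _ _ hs).
- move=> V h t; rewrite [ext_in _ _ _]extend_inE -hfun_res; congr (ext_in F V _).
  by rewrite -(unpull_res t (inverse_image_mono (f := k) (@sub_ptopen_over V)) h);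
    exact: (congr1 (fun h => mres M h _) (Prop_irrelevance _ _)).
- move=> V h e; rewrite [ext_out extend_extension _ _]extend_outE hfun_res.
  rewrite (mres_comp _ _ (inverse_image_mono (f := k) (@sub_ptopen_over V))).
  exact: (congr1 (fun h => mres M h _) (Prop_irrelevance _ _)).
Qed.

End Extend.

(** The comparison as data, with chosen inverses and with [to_over] as the fixed identification of
    opens. *)
Record canonical_iso (E : extension MY MY) (F : extension MS MS) := CanonicalIso {
  to_S : forall V : opens S, E (over V) -> F V;
  of_S : forall V : opens S, F V -> E (over V);
  to_SK : forall V e, of_S (to_S (V := V) e) = e;
  of_SK : forall V f, to_S (of_S (V := V) f) = f;
  to_S_linear : forall (V : opens S) (a : sec S V) e e',
    to_S ((comorph k V a : sec Y (over V)) *: e + e') = a *: to_S e + to_S e';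
  to_S_res : forall (V W : opens S) (h : W `<=` V) (h' : over W `<=` over V) e,
    to_S (mres E h' e) = mres F h (to_S e);
  to_S_in : forall (V : opens S) t,
    to_S (ext_in E (over V) t) = ext_in F V (mres M (@to_over V) t);
  to_S_out : forall (V : opens S) (e : E (over V)),
    ext_out F V (to_S e) = mres M (@to_over V) (ext_out E (over V) e) }.

(** The conclusion is an existential over [True] because data can only be extracted from a
    proposition inside a proposition. *)
Lemma canonical_isoP E F : @ext1_canonical _ _ _ U k M E F ->
  exists c : canonical_iso E F, True.
Proof.
move=> [phi [bij lin res inE outE]].
have ex (V : opens S) : exists psi, (forall e, psi (phi V e) = e) /\
    (forall f, phi V (psi f) = f).
  by have [psi phiK psiK] := bij V; exists psi.
pose psi V := sval (cid (ex V)).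
have phiK V e : psi V (phi V e) = e := (svalP (cid (ex V))).1 e.
have psiK V f : phi V (psi V f) = f := (svalP (cid (ex V))).2 f.
by exists (@CanonicalIso E F phi psi phiK psiK lin res
  (fun V t => inE V (@to_over V) t) (fun V e => esym (outE V (@to_over V) e))).
Qed.

Section CanonicalIso.
Variables (E : extension MY MY) (F : extension MS MS) (c : canonical_iso E F).

Lemma of_S_linear (V : opens S) (a : sec S V) f f' :
  of_S c (a *: f + f') =
  (comorph k V a : sec Y (over V)) *: of_S c f + of_S c f'.
Proof. by rewrite -[RHS](to_SK c) to_S_linear !of_SK. Qed.

Lemma of_S_res (V W : opens S) (h : W `<=` V) (h' : over W `<=` over V) f :
  of_S c (mres F h f) = mres E h' (of_S c f).
Proof. by rewrite -[RHS](to_SK c) (to_S_res _ h) of_SK. Qed.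

Lemma of_S_in (V : opens S) n :
  of_S c (ext_in F V n) = ext_in E (over V) (mres M (@from_over V) n : MY (over V)).
Proof. by rewrite -[RHS](to_SK c) to_S_in mres_cancel. Qed.

Lemma of_S_out (V : opens S) f :
  ext_out E (over V) (of_S c f) = mres M (@from_over V) (ext_out F V f).
Proof. by rewrite -[in RHS](of_SK c f) to_S_out mres_cancel. Qed.

End CanonicalIso.

(** * Transport of morphisms of extensions between [Y] and [S] *)

Section Transport.
Variables (E1 E2 : extension MY MY) (F1 F2 : extension MS MS).
Variables (c1 : canonical_iso E1 F1) (c2 : canonical_iso E2 F2).

Definition push_hom_fun (h : omod_hom E1 E2) (V : opens S) : {linear F1 V -> F2 V}.
Proof.
apply: (@linear_of _ (F1 V) (F2 V) (fun f => to_S c2 (h (over V) (of_S c1 f)))).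
by move=> a f f'; rewrite of_S_linear linearP to_S_linear.
Defined.

Lemma push_hom_res h (V W : opens S) (hWV : W `<=` V) m :
  push_hom_fun h W (mres F1 hWV m) = mres F2 hWV (push_hom_fun h V m).
Proof.
have hE := over_mono hWV.
transitivity (to_S c2 (h (over W) (of_S c1 (mres F1 hWV m)))); first by [].
by rewrite (of_S_res c1 hWV hE) hfun_res (to_S_res c2 hWV).
Qed.

Definition push_hom h : omod_hom F1 F2 := OModHom (push_hom_res h).

Lemma push_homE h (V : opens S) f :
  push_hom h V f = to_S c2 (h (over V) (of_S c1 f)).
Proof. by []. Qed.

Lemma push_equiv : ext_equiv E1 E2 -> ext_equiv F1 F2.
Proof.
move=> [h [hin hout]]; exists (push_hom h); split=> V x; rewrite push_homE.
  by rewrite of_S_in hin to_S_in mres_cancel.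
by rewrite to_S_out hout of_S_out mres_cancel.
Qed.

Let supE2 : supported_at (set_val P) E2.
Proof. exact: supported_extension supported_pushY supported_pushY. Qed.

Let supF2 : supported_at (k P) F2.
Proof. exact: supported_extension supported_pushS supported_pushS. Qed.

Variable g : omod_hom F1 F2.

(* e' is the image of e under the morphism of O_Y-modules extending g. *)
Definition pulled (W : opens Y) (e : E1 W) (e' : E2 W) : Prop :=
  forall (V : opens S) (hW : over V `<=` W),
    mres E2 hW e' = of_S c2 (g V (to_S c1 (mres E1 hW e))).

(** Both sides commute with restriction and live in a module supported at [P], so one neighbourhood
    of [k P] decides for all. *)
Lemma pulledI (W : opens Y) (e : E1 W) (e' : E2 W) :
  (W (set_val P) -> exists (V : opens S) (hW : over V `<=` W), V (k P) /\
    mres E2 hW e' = of_S c2 (g V (to_S c1 (mres E1 hW e)))) -> pulled e e'.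
Proof.
move=> H V hW; have [VP|VP] := pselect (V (k P)); last first.
  by apply: supE2 => /overP.
have [|V0 [hW0 [V0P e0]]] := H; first by apply: hW; apply/overP.
have hl := @opensIl _ V V0; have hr := @opensIr _ V V0.
have IP : over (opensI V V0) (set_val P) by apply/overP.
apply: (supported_res_inj clY supE2 (h := over_mono hl) IP).
have hI := subset_trans (over_mono hl) hW.
rewrite -(of_S_res c2 hl) -hfun_res -(to_S_res c1 hl (over_mono hl)).
rewrite !(mres_comp _ _ hI) -(mres_comp hW0 (over_mono hr)) e0.
rewrite -(of_S_res c2 hr) -hfun_res -(to_S_res c1 hr (over_mono hr)).
by rewrite (mres_comp _ _ hI).
Qed.

Lemma pulled_exists (W : opens Y) (e : E1 W) : exists e', pulled e e'.
Proof.
have [WP|WP] := pselect (W (set_val P)); last by exists 0; apply: pulledI.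
(* Lifting the section 0 serves only to find a neighbourhood [V] of [k P] with [over V] inside
   [W]. *)
have [V [hW [_ [VP _ _]]]] := lift_at 0 WP (I : whole S (k P)).
have VP' : over V (set_val P) by apply/overP.
have [e' e'E] := supported_res_onto clY supE2 hW VP'
  (of_S c2 (g V (to_S c1 (mres E1 hW e)))).
by exists e'; apply: pulledI => _; exists V, hW.
Qed.

Lemma pulled_unique (W : opens Y) (e : E1 W) (e1 e2 : E2 W) :
  pulled e e1 -> pulled e e2 -> e1 = e2.
Proof.
move=> p1 p2; have [WP|WP] := pselect (W (set_val P)); last exact: supE2.
have [V [hW [_ [VP _ _]]]] := lift_at 0 WP (I : whole S (k P)).
have VP' : over V (set_val P) by apply/overP.
by apply: (supported_res_inj clY supE2 (h := hW) VP'); rewrite p1 p2.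
Qed.

Lemma pulled_linear (W : opens Y) (a : sec Y W) (e f : E1 W) (e' f' : E2 W) :
  pulled e e' -> pulled f f' -> pulled (a *: e + f) (a *: e' + f').
Proof.
move=> pe pf; apply: pulledI => WP.
have [V [hW [al [VP _ alE]]]] := lift_at a WP (I : whole S (k P)).
exists V, hW; split=> //; rewrite !mresD !mresZ pe pf.
rewrite -[restr hW a]/(restr hW a : sec Y (over V)) -alE to_S_linear linearP.
by rewrite of_S_linear.
Qed.

Definition pull_hom_fun (W : opens Y) : {linear E1 W -> E2 W}.
Proof.
apply: (@linear_of _ (E1 W) (E2 W) (fun e => sval (cid (pulled_exists e)))).
move=> a e f; apply: pulled_unique (svalP (cid (pulled_exists _))) _.
by apply: pulled_linear; exact: svalP (cid (pulled_exists _)).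
Defined.

Lemma pull_homP (W : opens Y) (e : E1 W) : pulled e (pull_hom_fun W e).
Proof. exact: svalP (cid (pulled_exists e)). Qed.

Lemma pull_hom_res (V W : opens Y) (h : W `<=` V) m :
  pull_hom_fun W (mres E1 h m) = mres E2 h (pull_hom_fun V m).
Proof.
apply: pulled_unique (pull_homP _) _ => O hO.
have hs := subset_trans hO h.
by rewrite (mres_comp _ _ hs) (mres_comp _ _ hs); exact: pull_homP.
Qed.

Definition pull_hom : omod_hom E1 E2 := OModHom pull_hom_res.

Lemma pull_equiv :
  (forall (V : opens S) n, g V (ext_in F1 V n) = ext_in F2 V n) ->
  (forall (V : opens S) f, ext_out F2 V (g V f) = ext_out F1 V f) ->
  ext_equiv E1 E2.
Proof.
move=> gin gout; exists pull_hom; split=> W x.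
  apply: pulled_unique (pull_homP _) _ => V hW.
  by rewrite -!hfun_res to_S_in gin of_S_in mres_cancel.
have [WP|WP] := pselect (W (set_val P)); last exact: supported_pushY.
have [V [hW [_ [VP _ _]]]] := lift_at 0 WP (I : whole S (k P)).
have VP' : over V (set_val P) by apply/overP.
apply: (supported_res_inj clY supported_pushY (h := hW) VP').
have pE : mres E2 hW (pull_hom W x) = _ := @pull_homP W x V hW.
rewrite -(hfun_res (ext_out E2)) -(hfun_res (ext_out E1)) pE of_S_out gout to_S_out.
by rewrite mres_cancel.
Qed.

End Transport.

Lemma canonical_add E1 E2 E3 F1 F2 F3 (c1 : canonical_iso E1 F1)
    (c2 : canonical_iso E2 F2) (c3 : canonical_iso E3 F3) :
  ext_add E1 E2 E3 -> ext_add F1 F2 F3.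
Proof.
move=> [sigma [slin sres sin sout]].
have fib (V : opens S) (f : F1 V * F2 V) : ext_out F1 V f.1 = ext_out F2 V f.2 ->
    ext_out E1 (over V) (of_S c1 f.1) = ext_out E2 (over V) (of_S c2 f.2).
  by move=> e; rewrite !of_S_out e.
exists (fun V f => to_S c3 (sigma (over V) (of_S c1 f.1, of_S c2 f.2))); split.
- move=> V a f f' /fib e /fib e'; rewrite /= !of_S_linear -to_S_linear.
  by congr (to_S c3 _); exact: (slin (over V) _ (_, _) (_, _) e e').
- move=> V W h f /fib e; have hE := over_mono h.
  rewrite /= (of_S_res c1 h hE) (of_S_res c2 h hE) -(to_S_res c3 h hE).
  by congr (to_S c3 _); exact: (sres _ _ hE (_, _) e).
- move=> V n1 n2; rewrite /= !of_S_in sin to_S_in; congr (ext_in F3 V _).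
  by rewrite mresD !mres_cancel.
- move=> V f /fib e; rewrite to_S_out.
  have -> := sout (over V) (_, _) e.
  by rewrite of_S_out mres_cancel.
Qed.

Lemma base_scalar_res (X : kspace K) (V W : opens X) (h : W `<=` V) x :
  restr h (base_scalar V x) = base_scalar W x.
Proof. exact: restr_comp. Qed.

Lemma canonical_scale (x : K) E1 E2 F1 F2 (c1 : canonical_iso E1 F1)
    (c2 : canonical_iso E2 F2) :
  ext_scale x E1 E2 -> ext_scale x F1 F2.
Proof.
move=> [h [hin hout]]; exists (push_hom c1 c2 h); split=> V y; rewrite push_homE.
  rewrite of_S_in hin to_S_in; congr (ext_in F2 V _).
  transitivity (mres M (@to_over V) (comorph (open_incl U) (over V)
    (base_scalar (over V) x) *: (mres M (@from_over V) y))); first by [].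
  transitivity (comorph k V (base_scalar V x) *: (y : M _)); last by [].
  by rewrite mresZ mres_cancel !comorph_scalar base_scalar_res.
by rewrite to_S_out hout of_S_out mres_cancel.
Qed.

Theorem ext1_canonical_isomorphism :
  ext1_isomorphism (@ext1_canonical _ _ _ U k M).
Proof.
split.
- by move=> E; exists (restrict_extension E); exact: restrict_canonical.
- by move=> F; exists (extend_extension F); exact: extend_canonical.
- move=> E1 E2 F1 F2 /canonical_isoP[c1 _] /canonical_isoP[c2 _].
  split; first exact: push_equiv.
  by move=> [g [gin gout]]; exact: pull_equiv gin gout.
- move=> E1 E2 E3 F1 F2 F3 /canonical_isoP[c1 _] /canonical_isoP[c2 _].
  by move=> /canonical_isoP[c3 _]; exact: canonical_add.
- move=> x E1 E2 F1 F2 /canonical_isoP[c1 _] /canonical_isoP[c2 _].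
  exact: canonical_scale.
Qed.

End Ext.

(** If every section vanishing on [C] were 0, the first power of the ideal of [C] would already
    vanish on [Y], forcing [n] to be at most 1. *)
Lemma multiplicity_nonreduced (K : fieldType) (X Y C : kspace K)
    (i : morph Y X) (c : morph C Y) (n : nat) :
  is_multiplicity i c n -> (1 < n)%N ->
  exists (W : opens Y) (g : sec Y W), comorph c W g = 0 /\ g <> 0.
Proof.
move=> [_ nmin] n1; apply: contrapT => H.
suff /nmin : in_ideal_power i c 1 by rewrite leqNgt n1.
move=> W f f0; apply: contrapT => fn0; apply: H.
exists (inverse_image i W), (comorph i W (f ord0)); split; first exact: f0.
by move=> e; apply: fn0; rewrite big_ord1.
Qed.

Theorem mainTheorem15 (R : realType)
  (X Cn C : kspace R[i]) (i : morph Cn X) (c : morph C Cn) (n : nat)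
  (Cn_pmc : primitive_multiple_curve i c n) (Cn_proj : projective Cn)
  (n_gt1 : (1 < n)%N)
  (U : opens Cn) (U_affine : affine_open U)
  (S : kspace R[i]) (S_surface : smooth_affine_surface S)
  (k : morph (open_sub U) S) (k_closed : closed_immersion k)
  (Z : kspace R[i]) (z : morph Z (open_sub U)) (z_closed : closed_immersion z)
  (d : nat) (d_gt0 : (0 < d)%N) (Z_length : has_length Z d)
  (P : open_sub U) (Z_support : range z = [set P])
  (Z_in_C : contained_in z c) :
  ext1_isomorphism
    (@ext1_canonical _ _ _ U k (pushforward z (structure_omod Z))) /\
  hilb_tangent_isomorphism (base_cst S) (base_cst (open_sub U)) (global_comorph k) d
    (subscheme_ideal z).
Proof.
have [[_ _ _] [smC irrC _] _ cmY redc _ mult] := Cn_pmc.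
have nonred := multiplicity_nonreduced mult n_gt1.
have [affS [sS _ _]] := S_surface.
split.
  apply: (@ext1_canonical_isomorphism _ _ _ _ _ _ P).
  - exact: (support_closed cmY smC redc U_affine z_closed Z_length Z_support).
  - exact: (support_closed_in_surface cmY smC redc U_affine S_surface k_closed
      z_closed Z_length Z_support).
  - exact: (support_closed_in_open cmY smC redc U_affine z_closed Z_length Z_support).
  (* The inverse image in [Z] of an open missing [P] is empty, with zero ring of sections. *)
  - move=> V VP m m'; apply: sec_empty => x zx; apply: VP.
    by rewrite -(support_point Z_support x).
  - exact: closed_immersion_inj k_closed sS.
  - by move=> W V s WP VP; exact: (closed_immersion_lift k_closed sS s WP VP).
  - move=> V a VP a0.
    have [V' [h [f1 [f2 [V'P aE f10 f20]]]]] := surface_kernel_square cmY smC irrC redc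
      U_affine S_surface k_closed z_closed Z_length Z_support Z_in_C nonred VP a0.
    (* Scalars act on the pushforward of the structure sheaf of [Z] through their pullbacks to [Z],
       which are 0 here. *)
    exists V', h, f1, f2; split=> // m.
      by rewrite -[LHS]/(comorph z _ _ * (m : sec Z _)) f10 mul0r.
    by rewrite -[LHS]/(comorph z _ _ * (m : sec Z _)) f20 mul0r.
apply: hilb_tangent_iso_of_square.
- exact: global_comorph_onto.
- exact: global_comorph_scalar.
- move=> g g0; exact: (surface_kernel_square_global cmY smC irrC redc
      U_affine S_surface k_closed z_closed Z_length Z_support Z_in_C nonred g0).
Qed.
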